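(* Let $m\ge n$, let $\hat{\mathcal{U}}\subset\mathbb{R}^m$ be open, let $G,F\in C^3(\hat{\mathcal{U}},\mathbb{R}^n)$ and $C\in C^3(\hat{\mathcal{U}},\mathbb{R}^{m-n})$. Assume that for all $u\in\hat{\mathcal{U}}$ $$\det\begin{bmatrix}DG(u)\\ DC(u)\end{bmatrix}\neq0,$$ and that for all $u\in\hat{\mathcal{U}}$ and $k\in\{1,\dots,n\}$ there exist (non-zero) $r_k(u)\in\mathbb{R}^m$ and $\lambda_k(u)\in\mathbb{R}$ solving $(\lambda_kDG-DF)r_k=0$ and $DC\,r_k=0$, with $\lambda_1(u)<\dots<\lambda_n(u)$. Then, locally, $C^{-1}(0)$ equals the image of the integral curves of the eigenvectors $r_k$; that is, for each $u_l\in\hat{\mathcal{U}}$ with $C(u_l)=0$ there exists $\mathcal{U}\subset\hat{\mathcal{U}}$ (a neighborhood of $u_l$) such that $$C^{-1}(0)\cap\mathcal{U}=\left\{u\in\hat{\mathcal{U}}:\ u=S^n_{\epsilon_n}\cdots S^1_{\epsilon_1}u_l\right\}$$ (with parameters $\epsilon_1,\dots,\epsilon_n$ ranging over a neighborhood of $0$). Moreover, the integral curves of the $r_k$ define a local parameterization of $C^{-1}(0)$ if and only if there exists a coordinate system of Riemann invariants.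
   Context: $D$ denotes differentiation in $\mathbb{R}^m$. The vector fields $u\mapsto r_k(u)$ are fixed $C^2$ eigenvector fields. $S^k_{\epsilon}u'$ denotes the point reached at parameter value $\epsilon$ by the integral curve of $r_k$ emanating from $u'$, i.e. $S^k_\epsilon u'=u_k(\epsilon)$ where $\frac{du_k}{d\epsilon}=r_k(u_k(\epsilon))$, $u_k(0)=u'$. ''The integral curves of the $r_k$ define a local parameterization of $C^{-1}(0)$'' means that $(\epsilon_1,\dots,\epsilon_n)$ define coordinates on $C^{-1}(0)$ near $u_l$, in the sense that the representation $u=S^n_{\epsilon_n}\cdots S^1_{\epsilon_1}u_l$ holds independently of the order in which the maps $S^k_{\epsilon_k}$ are composed. A Riemann invariant $\omega_j$ is a scalar function which satisfies $r_i^{\,\nu}\partial_\nu\omega_j=0$ for all $i,j\in\{1,\dots,n\}$ with $i\neq j$, i.e. the derivative of $\omega_j$ in the direction $r_i$ vanishes for $i\ne j$. A coordinate system of Riemann invariants is a local coordinate system $(\omega_1,\dots,\omega_n)$ on $C^{-1}(0)$ consisting of Riemann invariants.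
   Formalization: In the ''if and only if'', the integral curves of the r_k are taken up to rescaling: r_k may be replaced near u_l by a_k r_k with nonzero C² factors a_k, since for fixed r_k the claim fails, e.g. r_1=(1,0), r_2=(0,exp u_1). Coordinate systems are C³. *)

(* Defs.v *)
From HB Require Import structures.
From mathcomp Require Export all_boot all_order all_algebra.
From mathcomp Require Export all_classical all_reals all_analysis.

Set Implicit Arguments.
Unset Strict Implicit.
Unset Printing Implicit Defensive.

Export Order.TTheory GRing.Theory Num.Theory.
Export numFieldNormedType.Exports.

Local Open Scope classical_set_scope.
Local Open Scope ring_scope.

(* [Ck k U f]: f is of class C^k on the open set U.  Quantifying over all
   directions v is, in finite dimension, the same as quantifying over the
   partial derivatives. *)
Fixpoint Ck (R : realType) (V W : normedModType R) (k : nat) (U : set V)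
    (f : V -> W) : Prop :=
  match k with
  | 0 => forall u, U u -> {for u, continuous f}
  | k'.+1 => (forall u, U u -> differentiable f u) /\
             (forall v : V, Ck k' U (fun u => 'D_v f u))
  end.

(* Points of R^m are row vectors, and the library's [jacobian f u] satisfies
   'd f u v = v *m jacobian f u; its transpose is the usual (p x m) matrix. *)
Definition Jac (R : realType) (m p : nat) (f : 'rV[R]_m -> 'rV[R]_p)
    (u : 'rV[R]_m) : 'M[R]_(p, m) := (jacobian f u)^T.

Definition zero_set (R : realType) (m p : nat) (Uhat : set 'rV[R]_m)
    (C : 'rV[R]_m -> 'rV[R]_p) : set 'rV[R]_m := [set u | Uhat u /\ C u = 0].

(* [flow U X e u v]: v = S_e u, i.e. the integral curve of X in U emanating
   from u exists up to (and slightly beyond) parameter e and is at v there.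
   The flow is a partial map, hence the relation; e may be negative. *)
Definition flow (R : realType) (m : nat) (U : set 'rV[R]_m)
    (X : 'rV[R]_m -> 'rV[R]_m) (e : R) (u v : 'rV[R]_m) : Prop :=
  exists (a b : R) (c : R -> 'rV[R]_m),
    [/\ a < 0 < b, a < e < b, c 0 = u, c e = v &
        forall t, a < t < b -> U (c t) /\ is_derive t 1 c (X (c t))].

(* For s = [:: k1; ...; kl]: v = S^kl_(e kl) ... S^k1_(e k1) u, so the head of
   the sequence acts first. *)
Fixpoint flows (R : realType) (m n : nat) (U : set 'rV[R]_m)
    (X : 'I_n -> 'rV[R]_m -> 'rV[R]_m) (s : seq 'I_n) (e : 'rV[R]_n)
    (u v : 'rV[R]_m) : Prop :=
  match s with
  | [::] => v = u
  | k :: s' => exists w, flow U (X k) (e 0 k) u w /\ flows U X s' e w v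
  end.

(* A local C^3 coordinate system x on the subset M of R^m near u0, with domain
   M `&` U, range E and inverse (parameterization) psi. *)
Definition coordinates (R : realType) (m n : nat) (M : set 'rV[R]_m)
    (u0 : 'rV[R]_m) (U : set 'rV[R]_m) (E : set 'rV[R]_n)
    (x : 'rV[R]_m -> 'rV[R]_n) (psi : 'rV[R]_n -> 'rV[R]_m) : Prop :=
  [/\ open_nbhs u0 U, open E, Ck 3 U x, Ck 3 E psi &
      psi @` E = M `&` U /\ forall e, E e -> x (psi e) = e].

(* The parameters (e_1, ..., e_n) in u = S^n_(e_n) ... S^1_(e_1) ul are
   coordinates on M near ul, whatever the order of composition. *)
Definition flow_coordinates (R : realType) (m n : nat) (M W : set 'rV[R]_m)
    (X : 'I_n -> 'rV[R]_m -> 'rV[R]_m) (ul : 'rV[R]_m) : Prop :=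
  exists (U : set 'rV[R]_m) (E : set 'rV[R]_n)
         (eps : 'rV[R]_m -> 'rV[R]_n) (Phi : 'rV[R]_n -> 'rV[R]_m),
    [/\ U `<=` W, E 0, coordinates M ul U E eps Phi &
        forall e, E e -> forall s : seq 'I_n, perm_eq s (enum 'I_n) ->
          flows W X s e ul (Phi e)].

(* The integral curves of the r_k are taken as curves, up to C^2
   reparameterization: the eigenvectors are only determined up to nonzero
   factors a_k, and commutation of the flows depends on these factors (e.g. the
   flows of (1, 0) and (0, exp u_1) in R^2 do not commute, although u_1 and u_2
   are Riemann invariants). *)
Definition integral_curves_parameterize (R : realType) (m n : nat)
    (M Uhat : set 'rV[R]_m) (r : 'I_n -> 'rV[R]_m -> 'rV[R]_m)
    (ul : 'rV[R]_m) : Prop :=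
  exists (W : set 'rV[R]_m) (a : 'I_n -> 'rV[R]_m -> R),
    [/\ open_nbhs ul W, W `<=` Uhat,
        forall k, Ck 2 W (a k : 'rV[R]_m -> R^o),
        forall k u, W u -> a k u != 0 &
        flow_coordinates M W (fun k u => a k u *: r k u) ul].

(* Since the r_i are tangent to M, the derivative of w_j along r_i at a point
   of M only depends on w_j on M; the condition is imposed on M only. *)
Definition Riemann_invariant_coordinates (R : realType) (m n : nat)
    (M Uhat : set 'rV[R]_m) (r : 'I_n -> 'rV[R]_m -> 'rV[R]_m)
    (ul : 'rV[R]_m) : Prop :=
  exists (U : set 'rV[R]_m) (E : set 'rV[R]_n)
         (w : 'rV[R]_m -> 'rV[R]_n) (psi : 'rV[R]_n -> 'rV[R]_m),
    [/\ U `<=` Uhat, coordinates M ul U E w psi &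
        forall u, (M `&` U) u -> forall i j : 'I_n, i != j ->
          'D_(r i u) (fun v => w v 0 j : R^o) u = 0].

(* Main.v *)
(* The tangent space ker DC of C^-1(0) has dimension n and is spanned by the r_k,
   which are independent since the lam_k are distinct.  Composing the flows,
   after a displacement transversal to C^-1(0), gives a map of a neighborhood of
   0 in R^m onto a neighborhood of u_l; C being constant along the flows, the
   points of C^-1(0) are exactly those reached with displacement 0.  The map is
   not shown to be C^1 (which would require differentiating solutions with
   respect to initial data): the estimate
   |f x - f y - L (x - y)| <= c |x - y| near the base point, with c arbitrarily
   small, passes through compositions, holds for the flows of Lipschitz fields,
   and suffices for local openness when L is onto.
   If w are coordinates of Riemann invariants with inverse psi, then
   r_i / (D_{r_i} w_i) = d psi / d w_i, so the rescaled flows translate the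
   coordinates w and commute.  Conversely, if the flows can be composed in any
   order, composing the flow of a_i r_i last shows d Phi / d eps_i = a_i r_i,
   hence D_{r_i} eps_j = 0 for i <> j. *)
Require Import Defs.
From mathcomp Require Import ring lra.
Set Implicit Arguments.
Unset Strict Implicit.
Unset Printing Implicit Defensive.
Local Open Scope classical_set_scope.
Local Open Scope ring_scope.

(** * Curves and strict differentiability *)

Section curves.
Context {R : realType}.

Lemma rV_norm_le n (v : 'rV[R]_n) K :
  0 <= K -> (forall j, `|v 0 j| <= K) -> `|v| <= K.
Proof.
move=> K0 vK; rewrite /Num.Def.normr /= mx_normrE bigmax_le //= => -[i j] _ /=.
by rewrite ord1.
Qed.

Lemma coord_le_norm n (v : 'rV[R]_n) j : `|v 0 j| <= `|v|.
Proof.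
rewrite [leRHS]/Num.Def.normr /= mx_normrE.
exact: (le_bigmax _ (fun ij : 'I_1 * 'I_n => `|v ij.1 ij.2|) (0, j)).
Qed.

Lemma is_derive_coord n (V : normedModType R) (c : V -> 'rV[R]_n) (t h : V)
    (v : 'rV[R]_n) j :
  is_derive t h c v -> is_derive t h (fun s => c s 0 j : R^o) (v 0 j).
Proof.
move=> [dc <-]; rewrite derive_mx // mxE; apply: derivableP.
exact: (derivable_mxP _ _ _).1 dc 0 j.
Qed.

Lemma is_derive_row n (c : R -> 'rV[R]_n) (t : R) (v : 'rV[R]_n) :
  (forall j, is_derive t 1 (fun s : R => c s 0 j : R^o) (v 0 j)) ->
  is_derive t 1 c v.
Proof.
move=> dc; have cd : derivable c t 1.
  by apply/derivable_mxP => i j; rewrite ord1; have [] := dc j.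
apply: DeriveDef => //; rewrite derive_mx //; apply/rowP => j.
by rewrite mxE; have [] := dc j.
Qed.

Lemma is_derive_continuous (W : normedModType R) (c : R -> W) (t : R) v :
  is_derive t 1 c v -> {for t, continuous c}.
Proof.
by move=> [/derivable1_diffP dc _]; exact: differentiable_continuous.
Qed.

Lemma is_derive_comp (V W : normedModType R) (c : R -> V) (f : V -> W) (t : R) v :
  is_derive t 1 c v -> differentiable f (c t) ->
  is_derive t 1 (f \o c) ('D_v f (c t)).
Proof.
move=> [/derivable1_diffP dc <-] df.
have dfc : differentiable (f \o c) t by exact: differentiable_comp.
apply: DeriveDef; first exact: diff_derivable.
by rewrite !deriveE // diff_comp.
Qed.

Lemma is_derive_line (V : normedModType R) (x v : V) (t : R) :
  is_derive t 1 (fun s : R => x + s *: v) v.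
Proof.
rewrite -[X in is_derive _ _ _ X]add0r; apply: is_deriveD.
by apply: DeriveDef; [exact/derivable1_diffP | rewrite deriveE // diff_val scale1r].
Qed.

Lemma continuous_row n (c : R -> 'rV[R]_n) :
  continuous c -> forall j, continuous (fun s => c s 0 j : R^o).
Proof.
move=> cc j x.
exact: (continuous_comp (cc x) (@coord_continuous R _ _ 0 j (c x))).
Qed.

(** Since the norm is the sup norm, the scalar mean value theorem applied to each coordinate
    suffices, even though the intermediate point depends on the coordinate. The disjunctions allow
    [s] and [t] in either order. *)
Lemma row_mean_value n (c dc : R -> 'rV[R]_n) (s t : R) v K :
  (forall x, s <= x <= t \/ t <= x <= s -> is_derive x 1 c (dc x)) ->
  (forall x, s <= x <= t \/ t <= x <= s -> `|dc x - v| <= K) ->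
  `|c t - c s - (t - s) *: v| <= K * `|t - s|.
Proof.
wlog st : s t / s <= t => [wl hd hK|hd hK].
  have [st|/ltW ts] := leP s t; first exact: wl.
  have -> : c t - c s - (t - s) *: v = - (c s - c t - (s - t) *: v).
    by apply/rowP => j; rewrite !mxE; ring.
  rewrite normrN [`|t - s|]distrC; apply: wl => // x xst.
  - by apply: hd; tauto.
  - by apply: hK; tauto.
have K0 : 0 <= K.
  by apply: le_trans (hK s _); rewrite ?normr_ge0 // lexx st; left.
apply: rV_norm_le => [|j]; first by rewrite mulr_ge0.
have [x|x|x xst] := @MVT_segment R (fun s => c s 0 j) (fun s => dc s 0 j) _ _ st.
- rewrite in_itv /= => /andP[sx xt]; apply: is_derive_coord.
  by apply: hd; left; rewrite !ltW.
- apply: continuous_in_subspaceT => y; rewrite inE /= in_itv /= => yst.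
  by apply: is_derive_continuous (is_derive_coord j (hd _ (or_introl yst))).
rewrite !mxE => ->; rewrite mulrC -mulrBr normrM mulrC ler_wpM2r //.
move: xst; rewrite in_itv /= => xst.
by apply: le_trans (hK _ (or_introl xst)); have := coord_le_norm (dc x - v) j; rewrite !mxE.
Qed.

Lemma antiderivative (g : R -> R) (T : R) : continuous g ->
  exists G : R -> R,
    forall t : R, `|t| <= T -> is_derive t 1 (G : R -> R^o) (g t).
Proof.
move=> cg; have [T0|T0] := leP 0 T; last first.
  by exists (fun=> 0) => t tT; have := normr_ge0 t; lra.
(* The margin 1 puts [- T] and [T] in the interior of the interval of integration, so the derivative
   is two-sided there too. *)
exists (fun x => \int[lebesgue_measure]_(t in `[- (T + 1), x]) g t) => t.
rewrite ler_norml => tT.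
have [] := @continuous_FTC1_closed R g (- (T + 1)) t (T + 1).
- lra.
- apply: continuous_compact_integrable; first exact: segment_compact.
  exact: continuous_subspaceT.
- lra.
- exact: cg.
by move=> dG <-; rewrite derive1E; exact: derivableP.
Qed.

Lemma row_antiderivative n (g : R -> 'rV[R]_n) (T : R) : continuous g ->
  exists G : R -> 'rV[R]_n, G 0 = 0 /\
    forall t : R, `|t| <= T -> is_derive t 1 G (g t).
Proof.
move=> cg.
have /choice[G hG] : forall j : 'I_n, exists G : R -> R,
    forall t : R, `|t| <= T -> is_derive t 1 (G : R -> R^o) (g t 0 j).
  by move=> j; apply: antiderivative; exact: continuous_row.
exists (fun t => \row_j (G j t - G j 0)); split.
  by apply/rowP => j; rewrite !mxE subrr.
move=> t tT; apply: is_derive_row => j.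
rewrite (_ : (fun _ => _) = (G j : R -> R^o) - cst (G j 0)); last first.
  by apply/funext => s; rewrite mxE.
by rewrite -[g t 0 j]subr0; apply: is_deriveB; exact: hG.
Qed.

(** Strict differentiability at the single point [x0], with both [x] and [y] free. [L] is a bare
    function; additivity and bounds are assumed separately where they matter. *)
Definition strict_diff (V W : normedModType R) (f : V -> W) (x0 : V)
    (L : V -> W) : Prop :=
  forall c : R, 0 < c -> exists2 eta : R, 0 < eta & forall x y,
    `|x - x0| < eta -> `|y - x0| < eta ->
    `|f x - f y - L (x - y)| <= c * `|x - y|.

(** Mean value estimate along the segment from [y] to [x], on which the partial derivatives remain
    close to those at [u]. *)
Lemma Ck1_strict_diff m p (U : set 'rV[R]_m) (f : 'rV[R]_m -> 'rV[R]_p) u :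
  open U -> Ck 1 U f -> U u ->
  strict_diff f u (fun h => h *m jacobian f u).
Proof.
move=> oU [df cf] Uu c c0.
(* The errors of the [m] partial derivatives add up to at most [c]; the successor avoids a division
   by zero when [m] is 0. *)
pose c' := c / m.+1%:R.
have c'0 : 0 < c' by rewrite divr_gt0.
have near1 : \forall z \near u, U z /\ forall j : 'I_m,
    `|'D_(delta_mx 0 j) f z - 'D_(delta_mx 0 j) f u| <= c'.
  near=> z; split; first by near: z; exact: open_nbhs_nbhs.
  move=> j; move: j; near: z; apply: filter_forall => j.
  have := cf (delta_mx 0 j) u Uu => /cvgr_distC_le; exact.
have [e /= e0 he] := (nbhs_ballP _ _).1 near1; exists e => // x y xu yu.
pose gam (t : R) := y + t *: (x - y).
have gamin (t : R) : 0 <= t <= 1 \/ 1 <= t <= 0 -> `|gam t - u| < e.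
  move=> ht; have {}ht : 0 <= t <= 1 by case: ht => //; lra.
  have -> : gam t - u = (1 - t) *: (y - u) + t *: (x - u).
    apply/rowP => j; rewrite !mxE; ring.
  apply: le_lt_trans (ler_normD _ _) _; rewrite !normrZ.
  rewrite (ger0_norm (_ : 0 <= 1 - t)); last lra.
  rewrite (ger0_norm (_ : 0 <= t)); last lra.
  have [->|t0] := eqVneq t 0; first by rewrite mul0r subr0 mul1r addr0.
  have : t * `|x - u| < t * e by rewrite ltr_pM2l // lt_def t0; lra.
  have : (1 - t) * `|y - u| <= (1 - t) * e.
    by rewrite ler_wpM2l //; [lra | exact: ltW].
  lra.
have gamU (t : R) (ht : 0 <= t <= 1 \/ 1 <= t <= 0) : ball u e (gam t).
  by rewrite -ball_normE /= distrC; exact: gamin.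
have -> : f x - f y - (x - y) *m jacobian f u =
    (f \o gam) 1 - (f \o gam) 0 - (1 - 0) *: 'D_(x - y) f u.
  rewrite /gam /= scale1r scale0r addr0 subr0 scale1r deriveEjacobian; last exact: df.
  by rewrite addrC [y + _]addrC subrK addrC.
rewrite -[leRHS]mulr1 -[X in _ * X](_ : `|1 - 0| = 1); last by rewrite subr0 normr1.
apply: (@row_mean_value _ _ (fun t => 'D_(x - y) f (gam t))) => t ht.
- have [Ug _] := he _ (gamU t ht).
  by apply: is_derive_comp; [exact: is_derive_line | exact: df].
- have [Ug Dg] := he _ (gamU t ht).
  rewrite !deriveEjacobian; [|exact: df|exact: df].
  rewrite -mulmxBr {1}(row_sum_delta (x - y)) mulmx_suml.
  apply: le_trans (ler_norm_sum _ _ _) _.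
  apply: (@le_trans _ _ (\sum_(j < m) c' * `|x - y|)).
    apply: ler_sum => j _; rewrite -scalemxAl normrZ mulrC.
    apply: ler_pM => //; last exact: coord_le_norm.
    have := Dg j; rewrite (deriveEjacobian _ (df _ Ug)).
    by rewrite (deriveEjacobian _ (df _ Uu)) -mulmxBr.
  rewrite sumr_const card_ord -mulr_natl mulrA ler_wpM2r // /c'.
  rewrite mulrCA ger_pMr // ler_pdivrMr // mul1r ler_nat; exact: leqnSn.
Unshelve. all: by end_near. Qed.

End curves.

(** * Fixed points and the Cauchy problem *)

Section contraction.
Context {R : realType}.

Lemma ltr_half_pow (M e : R) : 0 < e -> exists k, M / 2 ^+ k < e.
Proof.
move=> e0; have [k Mk] : exists k : nat, M / e < k%:R.
  exists (Num.trunc (M / e)).+1; exact: truncnS_gt.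
exists k; rewrite ltr_pdivrMr ?exprn_gt0 // -ltr_pdivrMl // mulrC.
apply: lt_le_trans Mk _; rewrite -natrX ler_nat ltnW //; exact: ltn_expl.
Qed.

Lemma le0_half_pow (M a : R) : (forall k, a <= M / 2 ^+ k) -> a <= 0.
Proof.
move=> aM; rewrite leNgt; apply/negP => /(ltr_half_pow M)[k].
by rewrite ltNge aM.
Qed.

Lemma half_powS (M : R) k : M / 2 ^+ k.+1 = M / 2 ^+ k / 2.
Proof. by rewrite exprS invfM mulrA mulrAC. Qed.

Lemma halving_cvg n (x : nat -> 'rV[R]_n) (K : R) :
  (forall k, `|x k.+1 - x k| <= K / 2 ^+ k) ->
  exists l, forall k, `|l - x k| <= 2 * K / 2 ^+ k.
Proof.
move=> xK.
have K0 : 0 <= K by have := xK 0; rewrite expr0 divr1; apply: le_trans.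
(* The exact partial geometric sum is kept so that the induction closes; its subtracted term is
   dropped afterwards. *)
have tail k j : `|x (k + j)%N - x k| <= 2 * K / 2 ^+ k - 2 * K / 2 ^+ (k + j).
  elim: j => [|j IH]; first by rewrite addn0 !subrr normr0.
  rewrite addnS; have := xK (k + j)%N; rewrite half_powS.
  have := ler_normD (x (k + j).+1 - x (k + j)%N) (x (k + j)%N - x k).
  rewrite addrA subrK; lra.
have tail' k j : (k <= j)%N -> `|x j - x k| <= 2 * K / 2 ^+ k.
  move=> kj; have := tail k (j - k)%N; rewrite subnKC // => /le_trans; apply.
  by rewrite gerBl divr_ge0 ?exprn_ge0 // mulr_ge0.
have cx : cvgn x.
  apply: cauchy_cvg; apply: cauchy_exP => e e0.
  have [k ke] := ltr_half_pow (2 * K) e0; exists (x k).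
  exists k => // j /= kj; rewrite -ball_normE /= distrC.
  exact: le_lt_trans (tail' _ _ kj) ke.
exists (limn x) => k; apply/ler_addgt0Pl => e e0.
have /cvgr_distC_le/(_ _ e0)[N _ hN] : x j @[j --> \oo] --> limn x by exact: cx.
have := hN (maxn N k) (leq_maxl _ _); rewrite distrC.
have := tail' k (maxn N k) (leq_maxr _ _).
have := ler_normD (limn x - x (maxn N k)) (x (maxn N k) - x k).
rewrite addrA subrK; lra.
Qed.

(** Surjective half of the inverse function theorem. With [A] a right inverse of [L], the equation
    [f (x + A w) = y] is solved for [w] by a simplified Newton iteration. The iteration lives in
    R^n, so completeness of [V] does not enter. *)
Lemma strict_diff_open (V : normedModType R) n (f : V -> 'rV[R]_n) (x0 : V)
    (L : V -> 'rV[R]_n) (A : 'rV[R]_n -> V) (kA : R) :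
  strict_diff f x0 L -> (forall w, L (A w) = w) ->
  (forall a b, A (a - b) = A a - A b) ->
  0 < kA -> (forall w, `|A w| <= kA * `|w|) ->
  exists2 eta, 0 < eta & forall delta, delta <= eta ->
    open (f @` [set x | `|x - x0| < delta]).
Proof.
move=> fL LA AB kA0 Abound.
have A0 : A 0 = 0 by rewrite -[X in A X](subrr 0) AB subrr.
(* With this error constant, the map [w - f (x + A w)] contracts by the factor 1/2. *)
have c0 : 0 < (2 * kA)^-1 by rewrite invr_gt0; lra.
have [eta eta0 feta] := fL _ c0; exists eta => // delta deta.
rewrite openE => _ [x /= xd <-].
(* For [w] of norm at most [rho], [A w] covers at most half the distance left to the boundary of the
   ball. *)
pose rho := (delta - `|x - x0|) / kA / 2.
have rho0 : 0 < rho by rewrite !divr_gt0 // subr_gt0.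
have inball w : `|w| <= rho -> `|x + A w - x0| < delta.
  move=> wr; rewrite addrAC; apply: le_lt_trans (ler_normD _ _) _.
  have : kA * `|w| <= kA * rho by rewrite ler_pM2l.
  have -> : kA * rho = (delta - `|x - x0|) / 2 by rewrite /rho; field; lra.
  have := Abound w; lra.
have contr w w' : `|w| <= rho -> `|w'| <= rho ->
    `|f (x + A w) - f (x + A w') - (w - w')| <= `|w - w'| / 2.
  move=> wr wr'.
  have := feta _ _ (lt_le_trans (inball w wr) deta)
                   (lt_le_trans (inball w' wr') deta).
  have -> : x + A w - (x + A w') = A (w - w').
    by rewrite AB opprD addrACA subrr add0r.
  rewrite LA => /le_trans; apply.
  apply: le_trans (ler_wpM2l (ltW c0) (Abound _)) _.
  by rewrite mulrA [leRHS]mulrC ler_wpM2r // invfM mulfVK // gt_eqF.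
apply/nbhs_ballP; exists (rho / 2) => /=; first by rewrite divr_gt0.
move=> y; rewrite -ball_normE /= distrC => yrho.
(* Fixed points of [T] are the solutions. As [y] is within [rho / 2] of [f x], [T] maps the ball of
   radius [rho] into itself. *)
pose T w := w - f (x + A w) + y.
have T0 : T 0 = y - f x by rewrite /T A0 addr0 sub0r addrC.
have Tcontr w w' : `|w| <= rho -> `|w'| <= rho -> `|T w - T w'| <= `|w - w'| / 2.
  move=> wr wr'; have := contr w' w wr' wr; rewrite [`|w' - w|]distrC.
  congr (`|_| <= _); rewrite /T; apply/rowP => j; rewrite !mxE; ring.
pose z k := iter k T 0.
have zrho k : `|z k| <= rho.
  elim: k => [|k IH]; first by rewrite normr0 ltW.
  have := Tcontr (z k) 0 IH; rewrite normr0 subr0 T0 => /(_ (ltW rho0)).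
  have := ler_normD (T (z k) - (y - f x)) (y - f x); rewrite subrK /=.
  rewrite -/(z k); lra.
have zK k : `|z k.+1 - z k| <= `|y - f x| / 2 ^+ k.
  elim: k => [|k IH]; first by rewrite /= T0 subr0 expr0 divr1.
  rewrite half_powS; have := Tcontr _ _ (zrho k.+1) (zrho k).
  rewrite -!/(z _.+1); lra.
have [l lz] := halving_cvg zK.
have lrho : `|l| <= rho.
  rewrite -subr_le0; apply: (@le0_half_pow (2 * `|y - f x|)) => k.
  have := lz k; have := zrho k; have := ler_normD (l - z k) (z k).
  rewrite subrK; lra.
have lT : T l = l.
  apply/eqP; rewrite -subr_eq0 -normr_le0; apply/eqP => /=.
  apply/eqP; apply: (@le0_half_pow (2 * `|y - f x|)) => k.
  have := lz k; have := lz k.+1; have := Tcontr _ _ lrho (zrho k).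
  rewrite half_powS -[T (z k)]/(z k.+1) [`|l - z k.+1|]distrC.
  have := ler_normD (T l - z k.+1) (z k.+1 - l).
  rewrite addrA subrK; lra.
exists (x + A l); first exact: inball.
by have /eqP := lT; rewrite /T -subr_eq0 addrAC [l - _]addrC addrK addrC subr_eq0 => /eqP.
Qed.

(** A short-time substitute for the Gronwall inequality. Applied to the difference of two solutions,
    it gives uniqueness when [d t0] is 0, and Lipschitz dependence on the initial point in
    general. *)
Lemma growth_bound n (d dd : R -> 'rV[R]_n) (t0 tau L : R) :
  0 <= L -> 0 <= tau -> tau * L <= 2^-1 ->
  (forall t : R, `|t - t0| <= tau -> is_derive t 1 d (dd t)) ->
  (forall t : R, `|t - t0| <= tau -> `|dd t| <= L * `|d t|) ->
  forall t, `|t - t0| <= tau -> `|d t - d t0| <= 2 * L * `|t - t0| * `|d t0|.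
Proof.
move=> L0 tau0 tauL hd hdd.
have [||ts] := @EVT_max R (fun t => `|d t|) (t0 - tau) (t0 + tau).
- lra.
- apply: continuous_in_subspaceT => t; rewrite inE /= in_itv /= => tt.
  have /hd/is_derive_continuous dt : `|t - t0| <= tau.
    by rewrite ler_norml; lra.
  exact: (continuous_comp dt (@norm_continuous _ _ (d t))).
rewrite in_itv /= => tsin dmax.
have step t : `|t - t0| <= tau -> `|d t - d t0| <= L * `|d ts| * `|t - t0|.
  move=> tt; rewrite -[d t - d t0]subr0 -(scaler0 _ (t - t0)).
  have inn s : t0 <= s <= t \/ t <= s <= t0 -> `|s - t0| <= tau.
    by move: tt; rewrite !ler_norml; case=> /andP[]; lra.
  apply: (row_mean_value (dc := dd)) => s /inn st; first exact: hd.
  rewrite subr0; apply: le_trans (hdd _ st) _; rewrite ler_wpM2l // dmax //.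
  by move: st; rewrite ler_norml in_itv /=; lra.
have tst : `|ts - t0| <= tau by rewrite ler_norml; lra.
(* The estimate at the maximum point bounds the maximum by [|d t0|] plus half of itself; the half is
   absorbed. *)
have M2 : `|d ts| <= 2 * `|d t0|.
  have := step _ tst; have := ler_normD (d ts - d t0) (d t0); rewrite subrK.
  have : L * `|d ts| * `|ts - t0| <= L * `|d ts| * tau.
    by rewrite ler_wpM2l // mulr_ge0.
  have : tau * L * `|d ts| <= 2^-1 * `|d ts| by rewrite ler_wpM2r.
  lra.
move=> t tt; apply: le_trans (step _ tt) _.
have -> : 2 * L * `|t - t0| * `|d t0| = L * (2 * `|d t0|) * `|t - t0| by ring.
by rewrite ler_wpM2r // ler_wpM2l.
Qed.

Lemma lipschitz_continuous (V W : normedModType R) (f : V -> W) (L : R) :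
  0 <= L -> (forall x y, `|f x - f y| <= L * `|x - y|) -> continuous f.
Proof.
move=> L0 YL.
move=> x; apply/cvgrPdist_le => e e0.
have Le : 0 < e / (L + 1) by rewrite divr_gt0 //; lra.
near=> y; apply: le_trans (YL _ _) _.
have xy : `|x - y| <= e / (L + 1).
  by near: y; apply: cvgr_dist_le Le; exact: cvg_id.
apply: (@le_trans _ _ ((L + 1) * (e / (L + 1)))).
  by apply: ler_pM => //; lra.
by rewrite mulrC divfK // gt_eqF //; lra.
Unshelve. all: by end_near. Qed.

(** The 1-Lipschitz retraction of the line onto the interval of radius [T] around [a]. It serves to
    clamp time in [picard], and space coordinates in [local_flow]. *)
Definition clamp (a T t : R) : R := Num.max (a - T) (Num.min t (a + T)).

Lemma clamp_dist (a T t : R) : 0 <= T -> `|clamp a T t - a| <= T.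
Proof.
move=> T0; rewrite ler_distl /clamp le_max lexx /= ge_max ge_min lexx orbT; lra.
Qed.

Lemma clamp_id (a T t : R) : `|t - a| <= T -> clamp a T t = t.
Proof.
by rewrite ler_distl /clamp => /andP[at_ ta]; rewrite min_l ?max_r.
Qed.

Lemma clamp_lipschitz (a T s t : R) : `|clamp a T s - clamp a T t| <= `|s - t|.
Proof.
wlog st : s t / s <= t => [wl|].
  by have [/wl//|/ltW/wl] := leP s t; rewrite distrC [`|t - s|]distrC.
rewrite distrC [leRHS]distrC (ger0_norm (_ : 0 <= t - s)) ?subr_ge0 //.
rewrite /clamp; case: (leP s (a + T)) => sT; case: (leP t (a + T)) => tT;
  case: (leP (a - T) s) => s1; case: (leP (a - T) t) => t1;
  case: (leP (a - T) (a + T)) => T1; rewrite ler_norml; lra.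
Qed.

(** Picard iteration, contracting by [T * L <= 1/2] in the sup norm. Clamping time keeps every
    iterate continuous on the whole line, so that antiderivatives can be taken without restricting
    domains. *)
Lemma picard n (Y : 'rV[R]_n -> 'rV[R]_n) (L T : R) (u : 'rV[R]_n) :
  0 <= L -> 0 <= T -> T * L <= 2^-1 ->
  (forall x y, `|Y x - Y y| <= L * `|x - y|) ->
  exists c : R -> 'rV[R]_n, c 0 = u /\
    forall t : R, `|t| < T -> is_derive t 1 c (Y (c t)).
Proof.
move=> L0 T0 TL YL.
have Ycont := lipschitz_continuous L0 YL.
pose kap := clamp 0 T.
have kapT t : `|kap t| <= T by rewrite -[kap t]subr0; exact: clamp_dist.
have kap_id t : `|t| <= T -> kap t = t.
  by move=> tT; apply: clamp_id; rewrite subr0.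
have kap_cont : continuous kap.
  apply: (@lipschitz_continuous R R kap 1) => // x y.
  by rewrite mul1r; exact: clamp_lipschitz.
have kap0 : kap 0 = 0 by apply: kap_id; rewrite normr0.
(* [P c c'] says that [c'] is the Picard image of [c], frozen outside the interval of radius [T]. *)
pose P (c c' : R -> 'rV[R]_n) := exists G : R -> 'rV[R]_n,
  [/\ G 0 = 0, forall t : R, `|t| <= T -> is_derive t 1 G (Y (c t)) &
      forall t, c' t = u + G (kap t)].
(* Choice needs an image for every [c]; a discontinuous [c] gets itself as a dummy value. *)
have /choice[F hF] : forall c : R -> 'rV[R]_n, exists c' : R -> 'rV[R]_n,
    continuous c -> P c c' /\ continuous c'.
  move=> c; have [cc|nc] := pselect (continuous c); last by exists c.
  have Ycc : continuous (Y \o c).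
    by move=> t; exact: (continuous_comp (cc t) (Ycont (c t))).
  have [G [G0 dG]] := row_antiderivative T Ycc.
  exists (fun t => u + G (kap t)) => _; split; first by exists G; split.
  move=> t; apply: continuousD; first exact: cst_continuous.
  apply: (continuous_comp (kap_cont t)).
  exact: is_derive_continuous (dG _ (kapT t)).
have Phalf c c' e e' K : P c c' -> P e e' ->
    (forall t, `|c t - e t| <= K) -> forall t, `|c' t - e' t| <= K / 2.
  move=> [G [G0 dG cG]] [H [H0 dH eH]] ceK t.
  rewrite cG eH opprD addrACA subrr add0r.
  have inn s : 0 <= s <= kap t \/ kap t <= s <= 0 -> `|s| <= T.
    by have := kapT t; rewrite !ler_norml; case=> /andP[]; lra.
  have /= := @row_mean_value R n (fun s => G s - H s)
    (fun s => Y (c s) - Y (e s)) 0 (kap t) 0 (L * K).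
  rewrite G0 H0 scaler0 !subr0 => /(_ _ _)/le_trans; apply.
  - by move=> s /inn sT; apply: is_deriveB; [exact: dG | exact: dH].
  - by move=> s _; rewrite subr0; apply: le_trans (YL _ _) _; rewrite ler_wpM2l.
  have K0 : 0 <= K by apply: le_trans (ceK 0).
  have : L * K * `|kap t| <= L * K * T by rewrite ler_wpM2l // mulr_ge0.
  have : T * L * K <= 2^-1 * K by rewrite ler_wpM2r.
  lra.
pose x k := iter k F (fun=> u).
have xcont k : continuous (x k).
  by elim: k => [|k IH]; [exact: cst_continuous | have [] := hF _ IH].
have xP k : P (x k) (x k.+1) by have [] := hF _ (xcont k).
pose K := T * `|Y u|.
have xK k t : `|x k.+1 t - x k t| <= K / 2 ^+ k.
  elim: k t => [t|k IH t]; last by rewrite half_powS; exact: Phalf IH t.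
  have [G [G0 dG ->]] := xP 0; rewrite expr0 divr1 /x /= addrC addKr.
  have inn s : 0 <= s <= kap t \/ kap t <= s <= 0 -> `|s| <= T.
    by have := kapT t; rewrite !ler_norml; case=> /andP[]; lra.
  have := @row_mean_value R n G (fun=> Y u) 0 (kap t) 0 `|Y u|.
  rewrite G0 scaler0 !subr0 => /(_ _ _)/le_trans; apply.
  - by move=> s /inn sT; exact: dG.
  - by [].
  - by rewrite mulrC ler_wpM2r.
have /choice[c hc] : forall t, exists l, forall k,
    `|l - x k t| <= 2 * K / 2 ^+ k.
  by move=> t; apply: halving_cvg => k; exact: xK.
have ccont : continuous c.
  move=> t; apply/cvgrPdist_le => e e0.
  have e3 : 0 < e / 3 by lra.
  have [k ke] := ltr_half_pow (2 * K) e3.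
  near=> s.
  have := hc t k; have := hc s k; rewrite [`|c s - _|]distrC.
  have : `|x k t - x k s| <= e / 3.
    by near: s; apply: cvgr_dist_le e3; exact: xcont.
  have := ler_normD (c t - x k t) (x k t - c s).
  have := ler_normD (x k t - x k s) (x k s - c s).
  rewrite !addrA !subrK; lra.
have [[G [G0 dG FG]] _] := hF _ ccont.
(* The limit is a fixed point: both [c] and [F c] are within a multiple of [1 / 2 ^+ k] of the
   iterate [x k.+1]. *)
have Fc t : c t = u + G (kap t).
  apply/eqP; rewrite -FG -subr_eq0 -normr_le0.
  apply: (@le0_half_pow (2 * K)) => k.
  have := hc t k.+1; rewrite half_powS.
  have PF : P c (F c) by exists G.
  have := Phalf _ _ _ _ _ PF (xP k) (hc^~ k) t.
  have := ler_normD (c t - x k.+1 t) (x k.+1 t - F c t).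
  rewrite addrA subrK [`|x k.+1 t - _|]distrC; lra.
exists c; split; first by rewrite Fc kap0 G0 addr0.
(* Near a time strictly inside the interval the clamp is the identity, so [c] agrees with [u + G]
   there. *)
move=> t tT; apply: (@near_eq_is_derive _ _ _ (cst u + G)); last first.
  by rewrite -[Y _]add0r; apply: is_deriveD; apply: dG; exact: ltW.
near=> s; rewrite Fc kap_id //; near: s.
have cn : {for t, continuous (fun s : R => `|s|)} by exact: norm_continuous.
exact: (cvgr_le _ cn).
Unshelve. all: by end_near. Qed.

End contraction.

(** * Flows *)

Section flows.
Context {R : realType}.

(** * Bounds and composition for strictly differentiable maps *)

Lemma row_mul_bounded m p (J : 'M[R]_(m, p)) :
  exists2 k : R, 0 < k & forall h : 'rV[R]_m, `|h *m J| <= k * `|h|.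
Proof.
exists (1 + \sum_j `|row j J|) => [|h].
  by rewrite ltr_pwDl // sumr_ge0.
rewrite [h in leLHS]row_sum_delta mulmx_suml.
apply: le_trans (ler_norm_sum _ _ _) _.
apply: (@le_trans _ _ (\sum_j `|row j J| * `|h|)).
  apply: ler_sum => j _; rewrite -scalemxAl -rowE normrZ mulrC.
  by rewrite ler_wpM2l // coord_le_norm.
by rewrite -mulr_suml ler_wpM2r // lerDr.
Qed.

Lemma strict_diff_lipschitz (V W : normedModType R) (f : V -> W) x0
    (L : V -> W) (k : R) :
  strict_diff f x0 L -> 0 < k -> (forall h, `|L h| <= k * `|h|) ->
  exists2 eta : R, 0 < eta & forall x y,
    `|x - x0| < eta -> `|y - x0| < eta -> `|f x - f y| <= (k + 1) * `|x - y|.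
Proof.
move=> /(_ 1 ltr01)[eta eta0 fL] k0 Lk; exists eta => // x y xe ye.
have := fL x y xe ye; have := Lk (x - y).
have := ler_normD (f x - f y - L (x - y)) (L (x - y)).
rewrite subrK; lra.
Qed.

(** The error splits into the error of [g] at [f x], [f y] and the image under [M] of the error of
    [f]. The constants [c1] and [c2] make each at most [c / 2] times the distance. *)
Lemma strict_diff_comp (V W Z : normedModType R) (f : V -> W) (g : W -> Z) x0
    (L : V -> W) (M : W -> Z) (kL kM : R) :
  strict_diff f x0 L -> strict_diff g (f x0) M ->
  0 < kL -> 0 < kM -> (forall h, `|L h| <= kL * `|h|) ->
  (forall h, `|M h| <= kM * `|h|) -> (forall a b, M (a - b) = M a - M b) ->
  strict_diff (g \o f) x0 (M \o L).
Proof.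
move=> fL gM kL0 kM0 Lk Mk MB c c0.
have [e1 e10 h1] := strict_diff_lipschitz fL kL0 Lk.
have c1 : 0 < c / (2 * kM) by rewrite divr_gt0 //; lra.
have [e2 e20 h2] := fL _ c1.
have c2 : 0 < c / (2 * (kL + 1)) by rewrite divr_gt0 //; lra.
have [e3 e30 h3] := gM _ c2.
exists (Num.min (Num.min e1 e2) (e3 / (kL + 1))) => [|x y].
  by rewrite !lt_min e10 e20 /= divr_gt0 //; lra.
rewrite !lt_min => /andP[/andP[x1 x2] x3] /andP[/andP[y1 y2] y3].
have near_f z : `|z - x0| < e1 -> `|z - x0| < e3 / (kL + 1) ->
    `|f z - f x0| < e3.
  move=> z1 z3; apply: le_lt_trans (h1 _ _ z1 _) _; rewrite ?subrr ?normr0 //.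
  by rewrite mulrC -ltr_pdivlMr //; lra.
have := h3 _ _ (near_f _ x1 x3) (near_f _ y1 y3).
have := h1 _ _ x1 y1; have := h2 _ _ x2 y2.
set r := f x - f y - L (x - y) => rb fb gb.
have -> : (g \o f) x - (g \o f) y - (M \o L) (x - y) =
    (g (f x) - g (f y) - M (f x - f y)) + M r.
  by have -> : M r = M (f x - f y) - M (L (x - y)); [exact: MB | rewrite addrA subrK].
apply: le_trans (ler_normD _ _) _.
have : c / (2 * (kL + 1)) * `|f x - f y| <= c / (2 * (kL + 1)) * ((kL + 1) * `|x - y|).
  by rewrite ler_wpM2l // ltW.
have -> : c / (2 * (kL + 1)) * ((kL + 1) * `|x - y|) = c / 2 * `|x - y|.
  by field; lra.
have : kM * `|r| <= kM * (c / (2 * kM) * `|x - y|) by rewrite ler_wpM2l // ltW.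
have -> : kM * (c / (2 * kM) * `|x - y|) = c / 2 * `|x - y|.
  by field; lra.
have := Mk r; lra.
Qed.

Lemma Ck1_locally_lipschitz m p (U : set 'rV[R]_m) (f : 'rV[R]_m -> 'rV[R]_p) u :
  open U -> Ck 1 U f -> U u ->
  exists L eta : R, [/\ 0 < L, 0 < eta,
    forall x, `|x - u| < eta -> U x & forall x y,
    `|x - u| < eta -> `|y - u| < eta -> `|f x - f y| <= L * `|x - y|].
Proof.
move=> oU fU Uu; have [k k0 hk] := row_mul_bounded (jacobian f u).
have [eta eta0 fl] := strict_diff_lipschitz (Ck1_strict_diff oU fU Uu) k0 hk.
have /nbhs_ballP[e /= e0 eU] : nbhs u U by exact: open_nbhs_nbhs.
exists (k + 1), (Num.min eta e); split; first lra.
- by rewrite lt_min eta0.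
- move=> x; rewrite lt_min => /andP[_ xe].
  by apply: eU; rewrite -ball_normE /= distrC.
- by move=> x y; rewrite !lt_min => /andP[x1 _] /andP[y1 _]; exact: fl.
Qed.

Lemma near_itvoo (a b t : R) : a < t < b -> \forall s \near t, a < s < b.
Proof.
move=> tab; have := @near_in_itvoo R a b t; rewrite in_itv /= => /(_ tab).
by apply: filterS => s; rewrite in_itv.
Qed.

(** The set of times where the curves agree is nonempty, relatively open by [growth_bound] with zero
    initial difference, and relatively closed by continuity; the interval is connected. *)
Lemma curve_unique m (U : set 'rV[R]_m) (X : 'rV[R]_m -> 'rV[R]_m)
    (a b t0 : R) (c1 c2 : R -> 'rV[R]_m) :
  open U -> Ck 1 U X -> a < t0 < b -> c1 t0 = c2 t0 ->
  (forall t : R, a < t < b -> U (c1 t) /\ is_derive t 1 c1 (X (c1 t))) ->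
  (forall t : R, a < t < b -> U (c2 t) /\ is_derive t 1 c2 (X (c2 t))) ->
  forall t, a < t < b -> c1 t = c2 t.
Proof.
move=> oU XU t0ab c12 hc1 hc2.

have local t : a < t < b -> c1 t = c2 t -> \forall s \near t, c1 s = c2 s.
  move=> tab ct; have [Uc1 dc1] := hc1 _ tab; have [_ dc2] := hc2 _ tab.
  have [L [eta [L0 eta0 _ XL]]] := Ck1_locally_lipschitz oU XU Uc1.
  have : \forall s \near t, [/\ a < s < b, `|c1 s - c1 t| < eta &
                              `|c2 s - c1 t| < eta].
    near=> s; split; near: s; first exact: near_itvoo.
      exact: cvgr_distC_lt (is_derive_continuous dc1) _ eta0.
    by rewrite ct; exact: cvgr_distC_lt (is_derive_continuous dc2) _ eta0.
  move=> /nbhs_ballP[d /= d0 hd].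
  (* The first bound keeps both curves where [X] is [L]-Lipschitz, the second is the smallness
     required by [growth_bound]. *)
  pose tau := Num.min (d / 2) (2 * L)^-1.
  have tau0 : 0 < tau by rewrite lt_min divr_gt0 //= invr_gt0; lra.
  have taud : tau < d.
    by apply: (@le_lt_trans _ _ (d / 2)); [rewrite ge_min lexx | lra].
  have tauL : tau * L <= 2^-1.
    have : tau <= (2 * L)^-1 by rewrite ge_min lexx orbT.
    rewrite -(ler_pM2r L0) => /le_trans; apply.
    by rewrite invfM mulfVK ?gt_eqF.
  have inb s : `|s - t| <= tau -> [/\ a < s < b, `|c1 s - c1 t| < eta &
                              `|c2 s - c1 t| < eta].
    by move=> st; apply: hd; rewrite -ball_normE /= distrC; exact: le_lt_trans taud.
  have gb := @growth_bound R m (fun s => c1 s - c2 s)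
    (fun s => X (c1 s) - X (c2 s)) t tau L (ltW L0) (ltW tau0) tauL.
  apply/nbhs_ballP; exists tau => // s; rewrite -ball_normE /= distrC => st.
  have := gb _ _ s (ltW st); rewrite ct subrr subr0 normr0 mulr0 normr_le0 subr_eq0.
  move=> h; apply/eqP; apply: h => r /inb[rab r1 r2].
    by have [_ ?] := hc1 _ rab; have [_ ?] := hc2 _ rab; apply: is_deriveB.
  exact: XL.
have conn : connected [set` `]a, b[].
  exact/connected_intervalP/interval_is_interval.
pose B := [set t | a < t < b /\ c1 t = c2 t].
suff BE : B = [set` `]a, b[].
  by move=> t tab; have [] : B t by rewrite BE /= in_itv.
apply: conn; first by exists t0.
- exists B; last first.
    apply/seteqP; split => [t [tab ct]|t [_ //]].
    by split => //=; rewrite in_itv.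
  rewrite openE => t [tab ct]; rewrite /interior.
  by near=> s; split; near: s; [exact: near_itvoo | exact: local].
- exists (closure B); first exact: closed_closure.
  apply/seteqP; split => [t Bt|t []].
    by split; [case: Bt => /=; rewrite in_itv | exact: subset_closure].
  rewrite /= in_itv /= => tab Bt; split => //.
  have [_ dc1] := hc1 _ tab; have [_ dc2] := hc2 _ tab.
  apply/eqP; rewrite -subr_eq0 -normr_le0 leNgt; apply/negP => d0.
  have cd : {for t, continuous (fun s => c1 s - c2 s)}.
    exact: is_derive_continuous (is_deriveB dc1 dc2).
  have near_d : \forall s \near t,
      `|(c1 s - c2 s) - (c1 t - c2 t)| < `|c1 t - c2 t|.
    by move: cd => /cvgr_distC_lt; apply.
  have [s [[_ cs]]] := Bt _ near_d.
  by rewrite /= cs subrr sub0r normrN ltxx.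
Unshelve. all: by end_near. Qed.

Lemma flow_unique m (U : set 'rV[R]_m) (X : 'rV[R]_m -> 'rV[R]_m)
    (e : R) (u v v' : 'rV[R]_m) :
  open U -> Ck 1 U X -> flow U X e u v -> flow U X e u v' -> v = v'.
Proof.
move=> oU XU [a [b [c [ab0 abe c0 <- hc]]]] [a' [b' [c' [ab0' abe' c0' <- hc']]]].
apply: (@curve_unique m U X (Num.max a a') (Num.min b b') 0) => //.
- by rewrite gt_max lt_min; lra.
- by rewrite c0 c0'.
- by move=> t; rewrite gt_max lt_min => tt; apply: hc; lra.
- by move=> t; rewrite gt_max lt_min => tt; apply: hc'; lra.
- by rewrite gt_max lt_min; lra.
Qed.

Lemma flows_unique m n (U : set 'rV[R]_m) (X : 'I_n -> 'rV[R]_m -> 'rV[R]_m)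
    (s : seq 'I_n) (e : 'rV[R]_n) (u v v' : 'rV[R]_m) :
  open U -> (forall k, Ck 1 U (X k)) ->
  flows U X s e u v -> flows U X s e u v' -> v = v'.
Proof.
move=> oU XU; elim: s u => /= [u -> -> //|k s IH u [w [uw wv]] [w' [uw' wv']]].
by apply: IH wv _; rewrite (flow_unique oU (XU k) uw uw').
Qed.

(** The curve witnessing the flow at time [e] extends beyond [e], and by uniqueness [g] coincides
    with it on a neighborhood of [e]. *)
Lemma flow_derive m (U : set 'rV[R]_m) (X : 'rV[R]_m -> 'rV[R]_m)
    (e : R) (u : 'rV[R]_m) (g : R -> 'rV[R]_m) :
  open U -> Ck 1 U X -> (\forall t \near e, flow U X t u (g t)) ->
  is_derive e 1 g (X (g e)).
Proof.
move=> oU XU hg; have [a [b [c [ab0 abe c0 ce hc]]]] := nbhs_singleton hg.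
rewrite -ce; apply: near_eq_is_derive (hc _ abe).2.
near=> t; apply: (@flow_unique m U X t u) => //.
  by exists a, b, c; split => //; near: t; exact: near_itvoo.
by near: t.
Unshelve. all: by end_near. Qed.

(* The field is made globally Lipschitz by clamping the coordinates of its
   argument, so that all solutions exist on a common time interval. *)
Lemma local_flow m (U : set 'rV[R]_m) (X : 'rV[R]_m -> 'rV[R]_m) p :
  open U -> Ck 1 U X -> U p ->
  exists Fl : R -> 'rV[R]_m -> 'rV[R]_m,
    [/\ Fl 0 p = p,
        exists2 eta : R, 0 < eta & forall (t : R) u,
          `|t| < eta -> `|u - p| < eta -> flow U X t u (Fl t u) &
        strict_diff (fun z : R * 'rV[R]_m => Fl z.1 z.2) (0, p)
          (fun z => z.1 *: X p + z.2)].
Proof.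
move=> oU XU Up; have [L [e0 [L0 e00 e0U XL]]] := Ck1_locally_lipschitz oU XU Up.
pose del := e0 / 2.
have del0 : 0 < del by rewrite divr_gt0.
have dele : del < e0 by rewrite /del; lra.
pose rho (u : 'rV[R]_m) : 'rV[R]_m := \row_j clamp (p 0 j) del (u 0 j).
have rho_p u : `|rho u - p| <= del.
  apply: rV_norm_le => [|j]; first exact: ltW.
  by rewrite !mxE; exact: clamp_dist (ltW del0).
have rho_lip u v : `|rho u - rho v| <= `|u - v|.
  apply: rV_norm_le => // j; rewrite !mxE; apply: le_trans (clamp_lipschitz _ _ _ _) _.
  by have := coord_le_norm (u - v) j; rewrite !mxE.
have rho_id u : `|u - p| <= del -> rho u = u.
  move=> up; apply/rowP => j; rewrite mxE clamp_id //.
  by apply: le_trans up; have := coord_le_norm (u - p) j; rewrite !mxE.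
pose Y u := X (rho u).
have YL u v : `|Y u - Y v| <= L * `|u - v|.
  apply: le_trans (XL _ _ _ _) _; rewrite ?(le_lt_trans (rho_p _)) //.
  by rewrite ler_wpM2l // ltW.
have Yp : Y p = X p by rewrite /Y rho_id // subrr normr0 ltW.
pose T := (2 * L)^-1.
have T0 : 0 < T by rewrite invr_gt0; lra.
have TL : T * L <= 2^-1 by rewrite /T invfM mulfVK ?gt_eqF.
have /choice[c hc] : forall u, exists c : R -> 'rV[R]_m, c 0 = u /\
    forall t : R, `|t| < T -> is_derive t 1 c (Y (c t)).
  by move=> u; exact: picard (ltW L0) (ltW T0) TL YL.
(* [B] bounds the speed of every solution of the clamped equation. *)
pose B := `|X p| + L * del.
have B0 : 0 <= B by rewrite addr_ge0 // mulr_ge0 // ltW.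
have YB u : `|Y u| <= B.
  have := XL (rho u) p; rewrite subrr normr0 => /(_ (le_lt_trans (rho_p _) dele) e00).
  have : L * `|rho u - p| <= L * del by rewrite ler_wpM2l // ltW.
  have := ler_normD (X (rho u) - X p) (X p); rewrite subrK -/(Y u) /B; lra.
have stay u t : `|t| < T -> `|c u t - u| <= B * `|t|.
  move=> tT; have [cu0 dcu] := hc u.
  have := @row_mean_value R m (c u) (fun s => Y (c u s)) 0 t 0 B.
  rewrite cu0 scaler0 !subr0; apply => s st; last by rewrite subr0.
  by apply: dcu; move: tT st; rewrite !ltr_norml => /andP[]; lra.
(* Starting within [eta] of [p] and moving for less than [eta] at speed at most [B], a solution
   stays within [del] of [p], where [Y] and [X] coincide. *)
pose eta := Num.min T (del / (B + 1)).
have eta0 : 0 < eta by rewrite lt_min T0 divr_gt0 //; lra.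
have etaT : eta <= T by rewrite ge_min lexx.
have stay_p u t e : `|t| < e -> e <= eta -> `|u - p| < e -> `|c u t - p| <= (B + 1) * e.
  move=> te ee up; have := stay u t (lt_le_trans te (le_trans ee etaT)).
  have : B * `|t| <= B * e by rewrite ler_wpM2l // ltW.
  have := ler_normD (c u t - u) (u - p); rewrite addrA subrK; lra.
have eta_del : (B + 1) * eta <= del.
  rewrite mulrC -ler_pdivlMr; last lra.
  by rewrite ge_min lexx orbT.
exists (fun t u => c u t); split; first by have [] := hc p.
- exists eta => // t u te up; exists (- eta), eta, (c u); have [cu0 dcu] := hc u.
  split; rewrite ?oppr_lt0 ?eta0 -?ltr_norml //.
  move=> s; rewrite -ltr_norml => se.
  have sp : `|c u s - p| <= del by apply: le_trans eta_del; exact: stay_p up.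
  split; first exact/e0U/(le_lt_trans sp).
  by have := dcu s (lt_le_trans se etaT); rewrite /Y rho_id.
(* [q] is chosen to make [L * ((B + 1) * q)] equal to [k / 4]. *)
move=> k k0; pose q := k / (4 * L * (B + 1)).
have den0 : 0 < 4 * L * (B + 1) by rewrite !mulr_gt0 //; lra.
have q0 : 0 < q by rewrite divr_gt0.
pose e := Num.min eta q.
have e_eta : e <= eta by rewrite ge_min lexx.
have e_gt0 : 0 < e by rewrite lt_min eta0.
have Le : L * ((B + 1) * e) <= k / 4.
  have -> : k / 4 = L * ((B + 1) * q) by rewrite /q; field; lra.
  rewrite ler_pM2l // ler_pM2l; [by rewrite ge_min lexx orbT | lra].
have Le' : 2 * L * e <= k / 2.
  have : L * (1 * e) <= L * ((B + 1) * e).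
    rewrite ler_pM2l // ler_pM2r //; lra.
  lra.
exists e => // -[t u] [t' u']; rewrite /= => xe ye.
have nle (z : R * 'rV[R]_m) : `|z.1| <= `|z| /\ `|z.2| <= `|z|.
  by rewrite [`|z|]prod_normE !le_max !lexx orbT.
have [tx ux] := nle ((t, u) - (0, p)).
have [ty uy] := nle ((t', u') - (0, p)).
have [d1 d2] := nle ((t, u) - (t', u')).
rewrite /= subr0 in tx; rewrite /= subr0 in ty.
have {}tx := le_lt_trans tx xe; have {}ux := le_lt_trans ux xe.
have {}ty := le_lt_trans ty ye; have {}uy := le_lt_trans uy ye.
rewrite /= in ux uy d1 d2.
have eT := le_trans e_eta etaT.
(* The increment is split at [c u t']: first a change of time along one solution, then in [t2] a
   change of initial point at a fixed time. *)
have t1 : `|c u t - c u t' - (t - t') *: X p| <= L * ((B + 1) * e) * `|t - t'|.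
  have inn s : t' <= s <= t \/ t <= s <= t' -> `|s| < e.
    by move: tx ty; rewrite !ltr_norml => /andP[? ?] /andP[? ?]; lra.
  apply: (row_mean_value (dc := fun s => Y (c u s))) => s /inn se.
    by apply: (hc u).2; exact: lt_le_trans eT.
  rewrite -Yp; apply: le_trans (YL _ _) _; rewrite ler_pM2l //.
  exact: stay_p ux.
have t2 : `|c u t' - c u' t' - (u - u')| <= 2 * L * `|t'| * `|u - u'|.
  have tL : `|t'| * L <= 2^-1.
    by apply: le_trans TL; rewrite ler_pM2r // ltW // (lt_le_trans ty).
  have := @growth_bound R m (fun s => c u s - c u' s)
    (fun s => Y (c u s) - Y (c u' s)) 0 `|t'| L (ltW L0) (normr_ge0 _) tL.
  rewrite /= (hc u).1 (hc u').1 => /(_ _ _ t').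
  rewrite !subr0; apply; [move=> s|by move=> s _; exact: YL|exact: lexx].
  rewrite subr0 => st; have sT : `|s| < T by apply: le_lt_trans st (lt_le_trans ty eT).
  by apply: is_deriveB; [exact: (hc u).2 | exact: (hc u').2].
have -> : c u t - c u' t' - ((t - t') *: X p + (u - u')) =
   (c u t - c u t' - (t - t') *: X p) + (c u t' - c u' t' - (u - u')).
  by apply/rowP => j; rewrite !mxE; ring.
apply: le_trans (ler_normD _ _) _.
have : L * ((B + 1) * e) * `|t - t'| <= k / 2 * `|((t, u) - (t', u'))|.
  apply: ler_pM => //.
    by rewrite mulr_ge0 ?ltW // mulr_gt0 //; apply: ltr_pwDr.
  by apply: le_trans Le _; rewrite ler_pM2l // lef_pV2 ?posrE // ler_nat.
have : 2 * L * `|t'| * `|u - u'| <= k / 2 * `|((t, u) - (t', u'))|.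
  apply: ler_pM => //; first by rewrite !mulr_ge0 //; lra.
  by apply: le_trans Le'; rewrite ler_pM2l ?ltW //; lra.
lra.
Qed.

(** Induction on [s]. The step carries the whole parameter vector along, as the map [f] sending
    [(e, u)] to [(e, Fl (e 0 k) u)], so that [strict_diff_comp] applies. *)
Lemma local_flows m n (U : set 'rV[R]_m) (X : 'I_n -> 'rV[R]_m -> 'rV[R]_m)
    (s : seq 'I_n) p :
  open U -> (forall k, Ck 1 U (X k)) -> U p ->
  exists P : 'rV[R]_n -> 'rV[R]_m -> 'rV[R]_m,
    [/\ P 0 p = p,
        exists2 eta : R, 0 < eta & forall e u,
          `|e| < eta -> `|u - p| < eta -> flows U X s e u (P e u) &
        strict_diff (fun z : 'rV[R]_n * 'rV[R]_m => P z.1 z.2) (0, p)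
          (fun z => \sum_(k <- s) z.1 0 k *: X k p + z.2)].
Proof.
move=> oU XU Up.
have nle (z : 'rV[R]_n * 'rV[R]_m) : `|z.1| <= `|z| /\ `|z.2| <= `|z|.
  by rewrite [`|z|]prod_normE !le_max !lexx orbT.
elim: s => [|k s [P [P0 [eta1 eta10 Pf] dP]]].
  exists (fun _ u => u); split => //; first by exists 1.
  move=> c c0; exists 1 => // -[e u] [e' u'] _ _ /=.
  by rewrite big_nil add0r subrr normr0 mulr_ge0 // ltW.
have [Fl [Fl0 [eta2 eta20 Flf] dF]] := local_flow oU (XU k) Up.
pose f (z : 'rV[R]_n * 'rV[R]_m) := (z.1, Fl (z.1 0 k) z.2).
pose L (z : 'rV[R]_n * 'rV[R]_m) := (z.1, z.1 0 k *: X k p + z.2).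
pose M (z : 'rV[R]_n * 'rV[R]_m) := \sum_(k <- s) z.1 0 k *: X k p + z.2.
have f0 : f (0, p) = (0, p) by rewrite /f /= mxE Fl0.
have df : strict_diff f (0, p) L.
  move=> c c0; have [e e0 he] := dF c c0; exists e => // x y xe ye.
  have lek (z t : 'rV[R]_n * 'rV[R]_m) :
      `|(z.1 0 k, z.2) - (t.1 0 k, t.2)| <= `|z - t|.
    have [h1 h2] := nle (z - t).
    rewrite [leLHS]prod_normE /= ge_max h2 andbT; apply: le_trans h1.
    by have := coord_le_norm (z.1 - t.1) k; rewrite !mxE.
  have xe' : `|(x.1 0 k, x.2) - (0, p)| < e.
    by apply: le_lt_trans xe; have := lek x (0, p); rewrite /= mxE.
  have ye' : `|(y.1 0 k, y.2) - (0, p)| < e.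
    by apply: le_lt_trans ye; have := lek y (0, p); rewrite /= mxE.
  have /= hF := he _ _ xe' ye'.
  rewrite prod_normE /= subrr normr0 max_r // !mxE.
  by apply: le_trans hF _; rewrite ler_pM2l //; exact: lek x y.
have Lb h : `|L h| <= (`|X k p| + 1) * `|h|.
  have [h1 h2] := nle h; rewrite [leLHS]prod_normE /= ge_max; apply/andP; split.
    by apply: le_trans h1 _; rewrite ler_peMl // lerDr.
  apply: le_trans (ler_normD _ _) _; rewrite normrZ mulrDl mul1r lerD //.
  by rewrite mulrC ler_wpM2l // (le_trans (coord_le_norm _ _)).
have Mb h : `|M h| <= (\sum_(k <- s) `|X k p| + 1) * `|h|.
  have [h1 h2] := nle h; rewrite /M.
  apply: le_trans (ler_normD _ _) _; rewrite mulrDl mul1r lerD //.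
  apply: le_trans (ler_norm_sum _ _ _) _; rewrite mulr_suml ler_sum // => j _.
  by rewrite normrZ mulrC ler_wpM2l // (le_trans (coord_le_norm _ _)).
have MB a b : M (a - b) = M a - M b.
  rewrite /M /= opprD addrACA -sumrB; congr (_ + _); apply: eq_bigr => j _.
  by rewrite -scalerBl !mxE.
exists (fun e u => P e (Fl (e 0 k) u)); split.
- by rewrite mxE Fl0.
- have [e0 e00 fl] := strict_diff_lipschitz df (ltr_pwDr ltr01 (normr_ge0 _)) Lb.
  pose kk := `|X k p| + 1 + 1.
  have kk0 : 0 < kk by rewrite /kk; have := normr_ge0 (X k p); lra.
  exists (Num.min (Num.min e0 (eta1 / kk)) (Num.min eta1 eta2)) => [|e u].
    by rewrite !lt_min e00 eta10 eta20 divr_gt0.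
  rewrite !lt_min => /andP[/andP[ee0 eek] /andP[ee1 ee2]].
  move=> /andP[/andP[ue0 uek] /andP[ue1 ue2]].
  have small (d : R) : `|e| < d -> `|u - p| < d -> `|(e, u) - (0, p)| < d.
    by move=> h1 h2; rewrite prod_normE /= subr0 gt_max h1.
  have Flp : `|Fl (e 0 k) u - p| < eta1.
    have [_ ] := nle (f (e, u) - f (0, p)); rewrite f0 /= => /le_lt_trans; apply.
    rewrite -f0; apply: le_lt_trans (fl _ _ (small _ ee0 ue0) _) _.
      by rewrite subrr normr0.
    by rewrite -/kk mulrC -ltr_pdivlMr // small.
  exists (Fl (e 0 k) u); split; last exact: Pf.
  by apply: Flf => //; exact: le_lt_trans (coord_le_norm _ _) ee2.
- have dP' : strict_diff (fun z : 'rV[R]_n * 'rV[R]_m => P z.1 z.2) (f (0, p)) M.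
    by rewrite f0.
  have := strict_diff_comp df dP' (ltr_pwDr ltr01 (normr_ge0 _))
    (ltr_pwDr ltr01 (sumr_ge0 _ (fun _ _ => normr_ge0 _))) Lb Mb MB.
  rewrite (_ : M \o L = fun z => \sum_(j <- k :: s) z.1 0 j *: X j p + z.2) //.
  by apply/funext => z; rewrite /M /L /= big_cons addrCA addrA.
Qed.

End flows.

(** * Functions of class C^k *)

Section Ck.
Context {R : realType}.

Lemma near_eq_differentiable (V W : normedModType R) (f g : V -> W) u :
  (\forall x \near u, f x = g x) -> differentiable f u -> differentiable g u.
Proof.
move=> fg dfu; have [cf ef] := (diff_locallyP _ _).1 dfu.
have eg : g \o shift u = cst (g u) + 'd f u +o_ 0 id.
  apply/eqaddoP => e e0; have /eqaddoP/(_ e e0) he := ef.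
  have fg0 : \forall h \near 0, f (h + u) = g (h + u).
    have := fg; rewrite (near_shift 0) subr0 /=.
    by apply: filterS => h; rewrite /= addrC.
  have fu := nbhs_singleton fg; apply: filterS2 he fg0 => h + fgh.
  by rewrite !fctE /= fu fgh.
have dg : 'd g u = 'd f u :> (V -> W) by exact: diff_unique.
by apply/diff_locallyP; rewrite dg.
Unshelve. all: by end_near. Qed.

Lemma Ck_ext (V W : normedModType R) k (U : set V) (f g : V -> W) :
  open U -> (forall u, U u -> f u = g u) -> Ck k U f -> Ck k U g.
Proof.
move=> oU; have near_fg (h h' : V -> W) : (forall u, U u -> h u = h' u) ->
    forall u, U u -> \forall x \near u, h x = h' x.
  move=> hh' u Uu; have := open_nbhs_nbhs (conj oU Uu).
  by apply: filterS => x; exact: hh'.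
elim: k f g => [|k IH] f g fg /=.
  move=> cf u Uu; have nfg := near_fg _ _ fg _ Uu.
  have := cf u Uu; rewrite /prop_for /continuous_at (fg _ Uu).
  by apply: cvg_trans; apply: near_eq_cvg; apply: filterS nfg.
move=> [df Cf]; split=> [u Uu|v].
  exact: near_eq_differentiable (near_fg _ _ fg _ Uu) (df u Uu).
apply: IH (Cf v) => u Uu; apply: near_eq_derive; exact: near_fg.
Qed.

Lemma Ck_sub (V W : normedModType R) k (U U' : set V) (f : V -> W) :
  U' `<=` U -> Ck k U f -> Ck k U' f.
Proof.
move=> UU; elim: k f => [|k IH] f /=; first by move=> cf u /UU; exact: cf.
by move=> [df Cf]; split=> [u /UU|v]; [exact: df | exact/IH/Cf].
Qed.

Lemma CkW (V W : normedModType R) k (U : set V) (f : V -> W) :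
  Ck k.+1 U f -> Ck k U f.
Proof.
elim: k f => [|k IH] f [df Cf]; first by move=> u /df/differentiable_continuous.
by split=> // v; exact/IH/Cf.
Qed.

Lemma Ck_cst (V W : normedModType R) k (U : set V) (c : W) : Ck k U (cst c : V -> W).
Proof.
elim: k c => [|k IH] c /=; first by move=> u _; exact: cst_continuous.
split=> [u _|v]; first exact: differentiable_cst.
rewrite (_ : (fun u => _) = cst 0); first exact: IH.
by apply/funext => u; exact: derive_cst.
Qed.

Lemma CkD (V W : normedModType R) k (U : set V) (f g : V -> W) :
  open U -> Ck k U f -> Ck k U g -> Ck k U (f + g).
Proof.
move=> oU; elim: k f g => [|k IH] f g /=.
  by move=> cf cg u Uu; apply: continuousD; [exact: cf | exact: cg].
move=> [df Cf] [dg Cg]; split=> [u Uu|v].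
  by apply: differentiableD; [exact: df | exact: dg].
apply: (@Ck_ext _ _ _ _ (fun u => 'D_v f u + 'D_v g u)) => // [u Uu|].
  by rewrite deriveD //; apply: diff_derivable; [exact: df | exact: dg].
exact: IH (Cf v) (Cg v).
Qed.

Lemma Ck_sum (V W : normedModType R) k (U : set V) n (f : 'I_n -> V -> W) :
  open U -> (forall i, Ck k U (f i)) -> Ck k U (fun u => \sum_i f i u).
Proof.
move=> oU; elim: n f => [|n IH] f Cf.
  apply: Ck_ext (Ck_cst k U (0 : W)) => // u _; by rewrite big_ord0.
apply: (@Ck_ext _ _ _ _ (f ord0 + (fun u => \sum_i f (lift ord0 i) u))) => //.
  by move=> u _; rewrite big_ord_recl.
by apply: CkD => //; exact: IH.
Qed.

Lemma CkM (V : normedModType R) k (U : set V) (f g : V -> R^o) :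
  open U -> Ck k U f -> Ck k U g -> Ck k U (fun u => f u * g u : R^o).
Proof.
move=> oU; elim: k f g => [|k IH] f g.
  by move=> /= cf cg u Uu; apply: (@continuousM R V f g); [exact: cf | exact: cg].
move=> /[dup] /CkW Ckf [df Cf] /[dup] /CkW Ckg [dg Cg]; split=> [u Uu|v].
  by apply: (@differentiableM R V f g); [exact: df | exact: dg].
apply: (@Ck_ext _ _ _ _ ((fun u => f u * 'D_v g u : R^o) +
                         (fun u => g u * 'D_v f u : R^o))) => // [u Uu|].
  have dfv : derivable f u v by exact: diff_derivable (df _ Uu).
  have dgv : derivable g u v by exact: diff_derivable (dg _ Uu).
  by rewrite [RHS](deriveM dfv dgv).
by apply: CkD => //; [exact: IH Ckf (Cg v) | exact: IH Ckg (Cf v)].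
Qed.

Lemma CkV (V : normedModType R) k (U : set V) (f : V -> R^o) :
  open U -> (forall u, U u -> f u != 0) -> Ck k U f ->
  Ck k U (fun u => (f u)^-1 : R^o).
Proof.
move=> oU f0; elim: k => [|k IH].
  by move=> /= cf u Uu; apply: (@continuousV R V f) => //; [exact: f0 | exact: cf].
move=> /[dup] /CkW Ckf [df Cf]; split=> [u Uu|v].
  by apply: (@differentiableV R V f); [exact: df | exact: f0].
have Ci := IH Ckf.
apply: (@Ck_ext _ _ _ _
  (fun u => (-1 : R^o) * ((f u)^-1 * ((f u)^-1 * 'D_v f u)) : R^o)) => // [u Uu|].
  have dfv : derivable f u v by exact: diff_derivable (df _ Uu).
  rewrite [RHS](deriveV (f0 _ Uu) dfv) mulN1r -[_ *: _]/(_ * _) mulNr mulrA.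
  by rewrite -invfM expr2.
apply: (@CkM _ _ _ (cst (-1))) => //; first exact: Ck_cst.
by apply: CkM => //; apply: CkM => //; exact: Cf.
Qed.

Lemma Ck_coord (V : normedModType R) k (U : set V) n (f : V -> 'rV[R]_n) j :
  open U -> Ck k U f -> Ck k U (fun u => f u 0 j : R^o).
Proof.
move=> oU; elim: k f => [|k IH] f /=.
  move=> cf u Uu.
  exact: (continuous_comp (cf u Uu) (@coord_continuous R _ _ 0 j (f u))).
move=> [df Cf]; split=> [u Uu|v].
  by apply: (@differentiable_comp _ _ _ _ f (fun v : 'rV[R]_n => v 0 j : R^o));
    [exact: df | exact: differentiable_coord].
apply: (@Ck_ext _ _ _ _ (fun u => 'D_v f u 0 j : R^o)) => // [u Uu|].
  by rewrite derive_mx ?mxE //; exact: diff_derivable (df _ Uu).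
exact/IH/Cf.
Qed.

Lemma Ck_row (V : normedModType R) k (U : set V) n (f : V -> 'rV[R]_n) :
  open U -> (forall j, Ck k U (fun u => f u 0 j : R^o)) -> Ck k U f.
Proof.
move=> oU; elim: k f => [|k IH] f Cf.
  move=> u Uu; apply/(@cvgrPdist_le _ _ _ (nbhs u)) => e e0.
  near=> x; apply: rV_norm_le; first exact: ltW.
  move=> j; rewrite !mxE; move: j; near: x; apply: filter_forall => j.
  by have := Cf j u Uu => /cvgrPdist_le; exact.
have df u : U u -> differentiable f u.
  move=> Uu; rewrite (_ : f = \sum_(j < n) (fun x => f x 0 j *: delta_mx 0 j)).
    apply: differentiable_sum => j; apply: differentiableZl.
    exact: (Cf j).1.
  by apply/funext => x; rewrite fct_sumE -row_sum_delta.
split=> // v; apply: IH => j.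
apply: (@Ck_ext _ _ _ _ ('D_v (fun u => f u 0 j : R^o))) => // [u Uu|].
  by rewrite derive_mx ?mxE //; exact: diff_derivable (df _ Uu).
exact: (Cf j).2.
Unshelve. all: by end_near. Qed.

Lemma Ck_scale (V : normedModType R) k (U : set V) n (a : V -> R^o)
    (f : V -> 'rV[R]_n) :
  open U -> Ck k U a -> Ck k U f -> Ck k U (fun u => a u *: f u).
Proof.
move=> oU Ca Cf; apply: Ck_row => // j.
apply: (@Ck_ext _ _ _ _ (fun u => a u * f u 0 j : R^o)) => // [u _|].
  by rewrite mxE.
by apply: CkM => //; exact: Ck_coord.
Qed.

Lemma Ck_shift (V W : normedModType R) k (U : set V) (f : V -> W) (w : V) :
  Ck k U f -> Ck k [set u | U (w + u)] (fun u => f (w + u)).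
Proof.
have cw (x : V) : {for x, continuous (fun u => w + u)}.
  by apply: continuousD; [exact: cst_continuous | exact: cvg_id].
elim: k f => [|k IH] f /=.
  by move=> cf u Uu; exact: (continuous_comp (cw u) (cf _ Uu)).
move=> [df Cf]; split=> [u Uu|v].
  apply: (@differentiable_comp _ _ _ _ (fun u => w + u) f); last exact: df.
  by apply: (@differentiableD _ _ _ (cst w) id).
rewrite (_ : 'D_v (fun u => f (w + u)) = fun u => 'D_v f (w + u)).
  exact: IH (Cf v).
apply/funext => u; rewrite /derive /=.
by under [in LHS]eq_fun do rewrite addrCA.
Qed.

(** [Ck] controls derivatives in fixed directions only; a direction varying with the point is
    expanded in the standard basis. *)
Lemma Ck1_derive_row m n (U : set 'rV[R]_m) (f : 'rV[R]_m -> 'rV[R]_n)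
    (X : 'rV[R]_m -> 'rV[R]_m) k j :
  open U -> Ck k.+1 U f -> Ck k U X ->
  Ck k U (fun u => 'D_(X u) f u 0 j : R^o).
Proof.
move=> oU [df Cf] CX.
apply: (@Ck_ext _ _ _ _ (fun u => \sum_l X u 0 l * 'D_(delta_mx 0 l) f u 0 j : R^o)) => //.
  move=> u Uu; rewrite (deriveEjacobian _ (df _ Uu)) [in RHS](row_sum_delta (X u)).
  rewrite mulmx_suml summxE; apply: eq_bigr => l _.
  by rewrite -scalemxAl mxE (deriveEjacobian _ (df _ Uu)).
apply: (@Ck_sum _ R^o _ _ _ (fun l u => X u 0 l * 'D_(delta_mx 0 l) f u 0 j)) => // l.
by apply: CkM => //; [exact: Ck_coord | exact/Ck_coord/Cf].
Qed.

End Ck.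

(** * Linear algebra *)

Section linear_algebra.
Context {F : fieldType}.

(** Independence of eigenvectors for distinct eigenvalues, for a pencil: if [y *m V = 0], the
    combination with coefficients multiplied by the eigenvalues is killed by both [A] and [D], hence
    vanishes too. *)
Lemma eigvec_row_free m n p q (A B : 'M[F]_(m, p)) (D : 'M[F]_(m, q))
    (V : 'M[F]_(n, m)) (lam : 'I_n -> F) :
  injective lam -> (forall k, row k V != 0) ->
  (forall k, lam k *: (row k V *m A) = row k V *m B) -> V *m D = 0 ->
  (forall v : 'rV_m, v *m A = 0 -> v *m D = 0 -> v = 0) -> row_free V.
Proof.
move=> lam_inj V0 eigV VD inj; apply: inj_row_free => x xV.
have diagV : diag_mx (\row_k lam k) *m V *m A = V *m B.
  by apply/row_matrixP => k; rewrite !row_mul row_diag_mx -!scalemxAl -rowE mxE eigV.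
have step (y : 'rV_n) : y *m V = 0 -> y *m diag_mx (\row_k lam k) *m V = 0.
  move=> yV; apply: inj.
    by rewrite -[_ *m V]mulmxA -mulmxA diagV mulmxA yV mul0mx.
  by rewrite -mulmxA VD mulmx0.
(* Iterating, the coefficients of a relation may be multiplied by any product of factors
   [lam k - lam j]; taking all [j != k] isolates [x 0 k], as in Lagrange interpolation. *)
have prodV (s : seq 'I_n) :
    (\row_k (x 0 k * \prod_(j <- s) (lam k - lam j))) *m V = 0.
  elim: s => [|i s IH].
    rewrite (_ : \row_k _ = x) //.
    by apply/rowP => k; rewrite mxE big_nil mulr1.
  set y := \row_k _ in IH.
  rewrite (_ : \row_k _ = y *m diag_mx (\row_k lam k) - lam i *: y).
    by rewrite mulmxBl step // -scalemxAl IH scaler0 subr0.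
  by apply/rowP => k; rewrite mul_mx_diag !mxE big_cons; ring.
apply/rowP => k; rewrite mxE.
have := prodV [seq j <- enum 'I_n | j != k].
rewrite (_ : \row_k _ = (x 0 k * \prod_(j <- enum 'I_n | j != k) (lam k - lam j))
    *: delta_mx 0 k); last first.
  apply/rowP => i; rewrite !mxE eqxx /= big_filter.
  have [->|ik] := eqVneq i k; first by rewrite mulr1.
  by rewrite mulr0 (big_rem i) ?mem_enum //= ik subrr mul0r mulr0.
rewrite -scalemxAl -rowE => /eqP; rewrite scaler_eq0 (negbTE (V0 k)) orbF.
rewrite mulf_eq0 => /orP[/eqP //|]; rewrite prodf_seq_eq0 => /hasP[j _ /andP[jk]].
by rewrite subr_eq0 => /eqP/lam_inj kj; rewrite kj eqxx in jk.
Qed.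

Lemma eigvec_trmx m p (c : F) (A B : 'M[F]_(m, p)) (v : 'rV_m) :
  (c *: A^T - B^T) *m v^T = 0 -> c *: (v *m A) = v *m B.
Proof.
rewrite mulmxBl -scalemxAl -!trmx_mul => /eqP; rewrite subr_eq0 => /eqP h.
by apply: trmx_inj; rewrite -h; apply/matrixP => i j; rewrite !mxE.
Qed.

(** [A] is injective on the kernel of [D], so this kernel has dimension at most [n] and [D] has rank
    at least [q]. *)
Lemma ker_row_full m n q (A : 'M[F]_(m, n)) (D : 'M[F]_(m, q)) :
  (n + q = m)%N -> (forall v : 'rV_m, v *m A = 0 -> v *m D = 0 -> v = 0) ->
  row_full D.
Proof.
move=> nq inj; have := mxrank_mul_ker (kermx D) A.
have -> : \rank (kermx D :&: kermx A) = 0%N.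
  apply/eqP; rewrite mxrank_eq0; apply/rowV0P => v.
  by rewrite sub_capmx => /andP[/sub_kermxP vD /sub_kermxP vA]; exact: inj.
rewrite addn0 mxrank_ker => rk; have := rank_leq_col (kermx D *m A).
rewrite rk => rkD; rewrite /row_full eqn_leq rank_leq_col /=.
by move: rkD; rewrite leq_subLR addnC -{1}nq leq_add2l.
Qed.

(** The row space of [V] lies in the kernel of [D], and both have dimension [n]. *)
Lemma ker_sub_row_free m n q (D : 'M[F]_(m, q)) (V : 'M[F]_(n, m)) (v : 'rV_m) :
  (n + q = m)%N -> row_full D -> row_free V -> V *m D = 0 -> v *m D = 0 ->
  (v <= V)%MS.
Proof.
move=> nq fD fV VD vD; have VK : (V <= kermx D)%MS by exact/sub_kermxP.
have := mxrank_leqif_sup VK; rewrite mxrank_ker (eqP fD) (eqP fV).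
have -> : (m - q = n)%N by rewrite -nq addnK.
move=> [_]; rewrite eqxx => /esym KV.
by apply: submx_trans KV; exact/sub_kermxP.
Qed.

Lemma castmx_col_mx_inj m n q (e : (n + q = m)%N) (A : 'M[F]_(n, m))
    (D : 'M[F]_(q, m)) (v : 'rV_m) :
  \det (castmx (e, erefl m) (col_mx A D)) != 0 ->
  v *m A^T = 0 -> v *m D^T = 0 -> v = 0.
Proof.
move=> detE vA vD; set M := castmx _ _ in detE.
have uM : M \in unitmx by rewrite unitmxE unitfE.
have Mv : M *m v^T = 0.
  have ADv : col_mx A D *m v^T = 0.
    rewrite mul_col_mx -[A]trmxK -[D]trmxK -!trmx_mul vA vD !trmx0.
    by rewrite col_mx0.
  apply/matrixP => i j.
  have h : \sum_k col_mx A D (cast_ord (esym e) i) k * v^T k j = 0.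
    have : (col_mx A D *m v^T) (cast_ord (esym e) i) j = 0 by rewrite ADv mxE.
    by rewrite mxE.
  rewrite [LHS]mxE [RHS]mxE -[RHS]h; apply: eq_bigr => k _.
  by rewrite castmxE /= cast_ord_id.
by apply: trmx_inj; rewrite trmx0 -(mulKmx uM v^T) Mv mulmx0.
Qed.

End linear_algebra.

(** * The zero set as a union of integral curves *)

Section zero_set_flows.
Context {R : realType}.

Lemma flow_mem m (U : set 'rV[R]_m) (X : 'rV[R]_m -> 'rV[R]_m) e u v :
  flow U X e u v -> U v.
Proof. by move=> [a [b [c [_ abe _ <- /(_ _ abe)[]]]]]. Qed.

Lemma flows_mem m n (U : set 'rV[R]_m) (X : 'I_n -> 'rV[R]_m -> 'rV[R]_m)
    s e u v : U u -> flows U X s e u v -> U v.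
Proof.
elim: s u => [u Uu -> //|k s IH u _ [w [/flow_mem Uw wv]]]; exact: IH wv.
Qed.

Lemma flow_first_integral m p (U : set 'rV[R]_m) (X : 'rV[R]_m -> 'rV[R]_m)
    (C : 'rV[R]_m -> 'rV[R]_p) e u v :
  (forall x, U x -> differentiable C x) ->
  (forall x, U x -> X x *m jacobian C x = 0) ->
  flow U X e u v -> C v = C u.
Proof.
move=> dC XC [a [b [c [ab0 abe <- <- hc]]]].
have inn (t : R) : 0 <= t <= e \/ e <= t <= 0 -> a < t < b by lra.
suff : `|(C \o c) e - (C \o c) 0 - (e - 0) *: 0| <= 0 * `|e - 0|.
  by rewrite mul0r scaler0 subr0 normr_le0 subr_eq0 => /eqP.
apply: (@row_mean_value R p _ (fun=> 0)) => t /inn tab; last by rewrite subr0 normr0.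
have [Uct dct] := hc _ tab; rewrite -(XC _ Uct) -(deriveEjacobian _ (dC _ Uct)).
by apply: is_derive_comp => //; exact: dC.
Qed.

Lemma flows_first_integral m n p (U : set 'rV[R]_m)
    (X : 'I_n -> 'rV[R]_m -> 'rV[R]_m) (C : 'rV[R]_m -> 'rV[R]_p) s e u v :
  (forall x, U x -> differentiable C x) ->
  (forall k x, U x -> X k x *m jacobian C x = 0) ->
  flows U X s e u v -> C v = C u.
Proof.
move=> dC XC; elim: s u => [u -> //|k s IH u [w [uw /IH ->]]].
exact: flow_first_integral (XC k) uw.
Qed.

(* Adding to the flow parameters a displacement transversal to the zero set
   turns the composed flow into a map onto a full neighborhood of p. *)
Lemma flows_zero_set m n q (U : set 'rV[R]_m) (X : 'I_n -> 'rV[R]_m -> 'rV[R]_m)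
    (C : 'rV[R]_m -> 'rV[R]_q) (p : 'rV[R]_m) :
  (n + q = m)%N -> open U -> U p -> C p = 0 -> Ck 1 U C ->
  (forall k, Ck 1 U (X k)) ->
  (forall k x, U x -> X k x *m jacobian C x = 0) ->
  row_full (jacobian C p) -> row_free (\matrix_k X k p) ->
  exists (V : set 'rV[R]_m) (E : set 'rV[R]_n),
    [/\ open_nbhs p V, V `<=` U, open_nbhs (0 : 'rV[R]_n) E,
        forall e, E e -> exists u, flows U X (enum 'I_n) e p u &
        zero_set U C `&` V =
          [set u | U u /\ exists2 e, E e & flows U X (enum 'I_n) e p u]].
Proof.
move=> nq oU Up Cp0 CC CX XC /row_fullP[B BJ] fX.
set J := jacobian C p in BJ; set M := \matrix_k X k p in fX.
have dC x : U x -> differentiable C x by exact: CC.1.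
have fJ : row_full J by apply/row_fullP; exists B.
have [P [P0 [e1 e10 Pf] dP]] := local_flows (enum 'I_n) oU CX Up.
(* Because [B *m J = 1], the displacement [y *m B] is transversal: the derivative of [C] sends it to
   [y]. *)
pose f (z : 'rV[R]_n * 'rV[R]_q) := (z.1, p + z.2 *m B).
pose L (z : 'rV[R]_n * 'rV[R]_q) := (z.1, z.2 *m B).
pose N (z : 'rV[R]_n * 'rV[R]_m) := \sum_(k <- enum 'I_n) z.1 0 k *: X k p + z.2.
pose Th (z : 'rV[R]_n * 'rV[R]_q) := P z.1 (p + z.2 *m B).
have NE z : N z = z.1 *m M + z.2.
  rewrite /N big_enum /= mulmx_sum_row; congr (_ + _).
  by apply: eq_bigr => k _; rewrite rowK.
have nle k l (z : 'rV[R]_k * 'rV[R]_l) : `|z.1| <= `|z| /\ `|z.2| <= `|z|.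
  by rewrite [`|z|]prod_normE !le_max !lexx orbT.
have [kB kB0 hB] := row_mul_bounded B.
have [kM kM0 hM] := row_mul_bounded M.
have [kJ kJ0 hJ] := row_mul_bounded J.
have [kK kK0 hK] := row_mul_bounded ((1%:M - J *m B) *m pinvmx M).
have f0 : f 0 = (0, p) by rewrite /f /= mul0mx addr0.
have df : strict_diff f 0 L.
  move=> c c0; exists 1 => // x y _ _.
  rewrite (_ : f x - f y - L (x - y) = 0) ?normr0 ?mulr_ge0 // ?ltW //.
  rewrite /f /L; apply/eqP; rewrite -pair_eqE /= /pair_eq /=.
  by rewrite subrr eqxx /= mulmxBl opprD addrACA subrr add0r subrr.
have dP' : strict_diff (fun z : 'rV[R]_n * 'rV[R]_m => P z.1 z.2) (f 0) N.
  by rewrite f0.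
have Lb h : `|L h| <= (kB + 1) * `|h|.
  have [h1 h2] := nle _ _ h; rewrite [leLHS]prod_normE /= ge_max; apply/andP; split.
    by apply: le_trans h1 _; rewrite ler_peMl // lerDr ltW.
  apply: le_trans (hB _) _; apply: ler_pM => //; first exact: ltW.
  by rewrite lerDl.
have Nb h : `|N h| <= (kM + 1) * `|h|.
  have [h1 h2] := nle _ _ h; rewrite NE; apply: le_trans (ler_normD _ _) _.
  rewrite mulrDl mul1r lerD //; apply: le_trans (hM _) _.
  by rewrite ler_wpM2l // ltW.
have NB a b : N (a - b) = N a - N b.
  by rewrite !NE /= mulmxBl opprD addrACA.
have dTh := strict_diff_comp df dP' (ltr_pwDr ltr01 (ltW kB0))
  (ltr_pwDr ltr01 (ltW kM0)) Lb Nb NB.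
(* A right inverse of the linear part: [w] is the sum of [w *m J *m B] and a remainder killed by
   [J], which lies in the span of the [X k p]. *)
pose A (w : 'rV[R]_m) := (w *m ((1%:M - J *m B) *m pinvmx M), w *m J).
have LA w : (N \o L) (A w) = w.
  rewrite /= NE /L /A /= mulmxA mulmxKpV.
    by rewrite mulmxBr mulmx1 mulmxA subrK.
  apply: (ker_sub_row_free nq fJ fX).
    by apply/row_matrixP => k; rewrite row_mul rowK row0; exact: XC.
  by rewrite mulmxBr mulmx1 mulmxBl -!mulmxA BJ mulmx1 subrr.
have AB a b : A (a - b) = A a - A b by rewrite /A !mulmxBl.
have Ab w : `|A w| <= (kK + kJ) * `|w|.
  rewrite [leLHS]prod_normE /= ge_max; apply/andP; split.
    by apply: le_trans (hK _) _; rewrite ler_wpM2r // lerDl ltW.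
  by apply: le_trans (hJ _) _; rewrite ler_wpM2r // lerDr ltW.
have [e2 e20 oTh] := strict_diff_open dTh LA AB (addr_gt0 kK0 kJ0) Ab.
(* This constant turns [C (p + y *m B) = 0] into [|y| <= |y| / 2], hence [y = 0]. *)
have kB2 : 0 < (2 * kB)^-1 by rewrite invr_gt0; lra.
have [e3 e30 hC] := Ck1_strict_diff oU CC Up kB2.
have /nbhs_ballP[e4 /= e40 e4U] : nbhs p U by exact: open_nbhs_nbhs.
pose d := Num.min (Num.min e1 e2) (Num.min (e1 / kB) (Num.min (e3 / kB) (e4 / kB))).
have d0 : 0 < d by rewrite !lt_min e10 e20 !divr_gt0.
have small (y : 'rV[R]_q) : `|y| < d ->
    [/\ `|p + y *m B - p| < e1, `|p + y *m B - p| < e3 & U (p + y *m B)].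
  rewrite !lt_min => /and4P[_ y1 y3 y4].
  have yB (e : R) : `|y| < e / kB -> `|p + y *m B - p| < e.
    by rewrite ltr_pdivlMr // addrC addKr => h; apply: le_lt_trans (hB _) _; rewrite mulrC.
  split; [exact: yB|exact: yB|].
  by apply: e4U; rewrite -ball_normE /= distrC; exact: yB.
have de1 : d <= e1 by rewrite !ge_min lexx.
have de2 : d <= e2 by rewrite !ge_min lexx orbT.
have ThE e (y : 'rV[R]_q) : `|e| < d -> `|y| < d ->
    flows U X (enum 'I_n) e (p + y *m B) (Th (e, y)).
  move=> ed yd; have [y1 _ _] := small _ yd.
  by apply: Pf => //; exact: lt_le_trans de1.
have ThE0 e : `|e| < d -> flows U X (enum 'I_n) e p (Th (e, 0)).
  by move=> ed; have := ThE e 0 ed; rewrite mul0mx addr0 normr0; exact.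
exists (Th @` [set z | `|z - 0| < d]), [set e | `|e| < d]; split.
- split; first exact: oTh.
  exists 0; first by rewrite /= subr0 normr0.
  by rewrite /Th /= mul0mx addr0.
- move=> _ [[e y] /= + <-]; rewrite subr0 => zd; have [/= ed yd] := nle _ _ (e, y).
  have {}yd := le_lt_trans yd zd; have [_ _ Uy] := small _ yd.
  by apply: flows_mem Uy (ThE _ _ _ yd); exact: le_lt_trans zd.
- split; last by rewrite /= normr0.
  have := @ball_open _ _ (0 : 'rV[R]_n) d; rewrite -ball_normE.
  by congr open; apply/seteqP; split => e /=; rewrite sub0r normrN.
- by move=> e /ThE0 h; exists (Th (e, 0)).
apply/seteqP; split => [u [[Uu Cu] [[e y] /= + Thu]]|u /= [Uu [e ed eu]]].
  rewrite subr0 => zd; split => //; have [/= ed yd] := nle _ _ (e, y).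
  have {}yd := le_lt_trans yd zd; have {}ed := le_lt_trans ed zd.
  (* [C] takes the same value at the end [u] of the composed flow and at its start [p + y *m B]. *)
  have Cy : C (p + y *m B) = 0.
    by rewrite -Cu -Thu (flows_first_integral dC XC (ThE _ _ ed yd)).
  have [_ y3 _] := small _ yd.
  have := hC _ _ y3; move=> /(_ p); rewrite subrr normr0 Cy Cp0 subr0 sub0r normrN.
  rewrite addrC addKr -mulmxA BJ mulmx1 => /(_ e30) yy.
  have : (2 * kB)^-1 * `|y *m B| <= (2 * kB)^-1 * (kB * `|y|) by rewrite ler_pM2l.
  have -> : (2 * kB)^-1 * (kB * `|y|) = `|y| / 2.
    by rewrite invfM -mulrA mulKf ?gt_eqF // mulrC.
  have ny := normr_ge0 y => yyB.
  have : `|y| <= 0 by lra.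
  rewrite normr_le0 => /eqP y0; exists e => //.
  by rewrite -Thu y0; exact: ThE0.
(* For the converse inclusion, uniqueness identifies any endpoint [u] with [Th (e, 0)]. *)
have uE := flows_unique oU CX eu (ThE0 _ ed).
split; first by split => //; rewrite (flows_first_integral dC XC eu).
exists (e, 0); last by rewrite uE.
by rewrite /= subr0 prod_normE /= normr0 max_l.
Qed.

End zero_set_flows.

(** * Riemann invariants *)

Section Riemann_invariants.
Context {R : realType}.

Lemma flows_rcons m n (U : set 'rV[R]_m) (X : 'I_n -> 'rV[R]_m -> 'rV[R]_m)
    s k e u v : flows U X (rcons s k) e u v ->
  exists2 w, flows U X s e u w & flow U (X k) (e 0 k) w v.
Proof.
elim: s u => [u [w [uw ->]]|i s IH u [w [uw /IH[x wx xv]]]].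
  by exists u.
by exists x => //; exists w.
Qed.

Lemma eq_flows m n (U : set 'rV[R]_m) (X : 'I_n -> 'rV[R]_m -> 'rV[R]_m)
    (s : seq 'I_n) (e e' : 'rV[R]_n) (u v : 'rV[R]_m) :
  {in s, forall k, e 0 k = e' 0 k} ->
  flows U X s e u v -> flows U X s e' u v.
Proof.
elim: s u => [//|k s IH] u ee' /= [w [uw wv]]; exists w; split.
  by rewrite -ee' ?mem_head.
by apply: IH wv => i si; apply: ee'; rewrite inE si orbT.
Qed.

(* Composing the flow of X_i last shows that the i-th parameter line of Phi is
   an integral curve of X_i; this is where the independence of the order of
   composition enters. *)
Lemma flow_coordinates_derive m n (W : set 'rV[R]_m)
    (X : 'I_n -> 'rV[R]_m -> 'rV[R]_m) (p : 'rV[R]_m) (E : set 'rV[R]_n)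
    (Phi : 'rV[R]_n -> 'rV[R]_m) (e : 'rV[R]_n) (i : 'I_n) :
  open W -> (forall k, Ck 1 W (X k)) -> open E -> E e ->
  (forall e, E e -> forall s : seq 'I_n, perm_eq s (enum 'I_n) ->
    flows W X s e p (Phi e)) ->
  is_derive (0 : R) 1 (fun t : R => Phi (e + t *: delta_mx 0 i)) (X i (Phi e)).
Proof.
move=> oW CX oE Ee hPhi.
pose s := [seq k <- enum 'I_n | k != i].
have ps : perm_eq (rcons s i) (enum 'I_n).
  rewrite perm_rcons perm_sym -(perm_filterC (pred1 i)).
  by rewrite filter_pred1_uniq ?enum_uniq ?mem_enum.
(* [ee t] is [e] with its [i]-th coordinate replaced by [t]. The flows along [s] do not see the
   change, so they all end at the same point [w]. *)
pose ee (t : R) := e + (t - e 0 i) *: delta_mx 0 i.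
have eei t : ee t 0 i = t by rewrite !mxE !eqxx /= mulr1 addrC subrK.
have ees t : {in s, forall k, ee t 0 k = e 0 k}.
  by move=> k; rewrite mem_filter => /andP[/negbTE ki _]; rewrite !mxE eqxx ki mulr0 addr0.
have [w pw wPhi] := flows_rcons (hPhi e Ee _ ps).
have ee0 : ee (e 0 i) = e by rewrite /ee subrr scale0r addr0.
have near_flow : \forall t \near e 0 i, flow W (X i) t w (Phi (ee t)).
  have cee : {for e 0 i, continuous ee}.
    have -> : ee = (fun x => x) \o (fun t => (e - e 0 i *: delta_mx 0 i) + t *: delta_mx 0 i).
      by apply/funext => t; rewrite /ee /= scalerBl addrA addrAC.
    exact: is_derive_continuous (is_derive_line _ _ _).
  have Enear : nbhs (ee (e 0 i)) E by rewrite ee0; exact: open_nbhs_nbhs.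
  have nearE : \forall t \near e 0 i, E (ee t) by exact: (cee _ Enear).
  apply: filterS nearE => t Et.
  have [w' pw' w'Phi] := flows_rcons (hPhi _ Et _ ps).
  rewrite eei in w'Phi.
  by rewrite (flows_unique oW CX pw (eq_flows (ees t) pw')).
have := flow_derive oW (CX i) near_flow; rewrite ee0 => dPhi.
have := @is_derive_comp R R _ (fun t => e 0 i + t *: 1) (fun t => Phi (ee t)) 0 1
  (is_derive_line _ _ _).
rewrite scale0r addr0 => /(_ _)dcomp.
have [der val] := dPhi; rewrite -val.
have -> : (fun t : R => Phi (e + t *: delta_mx 0 i)) =
    (fun t => Phi (ee t)) \o (fun t => e 0 i + t *: 1).
  by apply/funext => t; rewrite /ee /= addrAC subrr add0r [_ *: 1]mulr1.
by apply: dcomp; exact/derivable1_diffP.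
Qed.

Lemma derive_comp_line m n p (f : 'rV[R]_n -> 'rV[R]_m)
    (g : 'rV[R]_m -> 'rV[R]_p) (e v : 'rV[R]_n) :
  differentiable f e -> differentiable g (f e) ->
  is_derive (0 : R) 1 (fun t : R => g (f (e + t *: v)))
    (v *m jacobian f e *m jacobian g (f e)).
Proof.
move=> df dg; have := is_derive_line e v 0.
have e0 : e = e + 0 *: v by rewrite scale0r addr0.
rewrite -(deriveEjacobian _ df) -(deriveEjacobian _ dg) => /is_derive_comp dl.
have {}dl := dl _ f; rewrite -e0 in dl; have /is_derive_comp := dl df.
by move=> /(_ _ g); rewrite /= -e0; exact.
Qed.

Lemma near_line n (E : set 'rV[R]_n) (e v : 'rV[R]_n) :
  open E -> E e -> \forall t \near (0 : R), E (e + t *: v).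
Proof.
move=> oE Ee; have /is_derive_continuous := is_derive_line e v 0; apply.
by rewrite scale0r addr0; exact: open_nbhs_nbhs.
Qed.

Lemma left_inverse_jacobian m n (E : set 'rV[R]_n) (psi : 'rV[R]_n -> 'rV[R]_m)
    (x : 'rV[R]_m -> 'rV[R]_n) e :
  open E -> E e -> differentiable psi e -> differentiable x (psi e) ->
  (forall e, E e -> x (psi e) = e) ->
  jacobian psi e *m jacobian x (psi e) = 1%:M.
Proof.
move=> oE Ee dpsi dx xpsi; apply/row_matrixP => i.
rewrite !rowE mulmxA mulmx1.
have [_ <-] := derive_comp_line (delta_mx 0 i) dpsi dx.
have [_ dl] := is_derive_line e (delta_mx 0 i) 0; rewrite -[RHS]dl.
by apply: near_eq_derive; apply: filterS (near_line _ oE Ee) => t; exact: xpsi.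
Qed.

Lemma level_set_jacobian m n p (E : set 'rV[R]_n) (psi : 'rV[R]_n -> 'rV[R]_m)
    (C : 'rV[R]_m -> 'rV[R]_p) e :
  open E -> E e -> differentiable psi e -> differentiable C (psi e) ->
  (forall e, E e -> C (psi e) = 0) ->
  jacobian psi e *m jacobian C (psi e) = 0.
Proof.
move=> oE Ee dpsi dC Cpsi; apply/row_matrixP => i.
rewrite rowE mulmxA row0.
have [_ <-] := derive_comp_line (delta_mx 0 i) dpsi dC.
rewrite -[RHS](derive_cst (0 : 'rV[R]_p) (0 : R) 1).
by apply: near_eq_derive; apply: filterS (near_line _ oE Ee) => t; exact: Cpsi.
Qed.

(** The flow parameters [eps] are themselves the Riemann invariants: along the [i]-th parameter line
    [eps_j] is constant for [j != i], and the factor [a i u] is cancelled. *)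
Lemma integral_curves_Riemann m n (M Uhat : set 'rV[R]_m)
    (r : 'I_n -> 'rV[R]_m -> 'rV[R]_m) ul :
  (forall k, Ck 2 Uhat (r k)) ->
  integral_curves_parameterize M Uhat r ul ->
  Riemann_invariant_coordinates M Uhat r ul.
Proof.
move=> Cr [W [a [[oW _] WU Ca a0 [U [E [eps [Phi [UW _ co hPhi]]]]]]]].
exists U, E, eps, Phi; split => //; first exact: subset_trans UW WU.
have [[oU _] oE Ceps CPhi [PhiE epsPhi]] := co.
move=> u Mu i j ij; have [e Ee eu] : (Phi @` E) u by rewrite PhiE.
have Uu : U u by case: Mu.
have deps : differentiable eps u by case: Ceps => + _; exact.
have CX k : Ck 1 W (fun u => a k u *: r k u).
  apply/CkW/Ck_scale => //; exact: Ck_sub (Cr k).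
have dPhi := flow_coordinates_derive i oW CX oE Ee hPhi.
have deps' : differentiable eps (Phi (e + 0 *: delta_mx 0 i)).
  by rewrite scale0r addr0 eu.
have [_] := is_derive_coord j (is_derive_comp dPhi deps').
rewrite /= scale0r addr0 eu (deriveEjacobian _ deps) -scalemxAl mxE.
have -> : 'D_1 (fun t : R => eps (Phi (e + t *: delta_mx 0 i)) 0 j : R^o) (0 : R) = 0.
  rewrite -[RHS](derive_cst (e 0 j : R^o) (0 : R) 1).
  apply: near_eq_derive; apply: filterS (near_line (delta_mx 0 i) oE Ee) => t Et.
  by rewrite /= epsPhi // !mxE eqxx eq_sym (negbTE ij) mulr0 addr0.
move=> /esym/eqP; rewrite mulf_eq0 (negbTE (a0 i u (UW _ Uu))) /= => /eqP.
by rewrite -(deriveEjacobian _ deps) derive_mx ?mxE //; exact: diff_derivable.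
Qed.

(* Parameter lines through the origin in the sup-norm ball stay in the ball. *)
Lemma coordinate_flows m n (W : set 'rV[R]_m)
    (X : 'I_n -> 'rV[R]_m -> 'rV[R]_m) (Psi : 'rV[R]_n -> 'rV[R]_m) (d : R) :
  (forall x, `|x| < d -> [/\ W (Psi x), differentiable Psi x &
    forall k, 'D_(delta_mx 0 k) Psi x = X k (Psi x)]) ->
  forall (s : seq 'I_n) (e x : 'rV[R]_n), uniq s -> `|e| < d -> `|x| < d ->
    {in s, forall k, x 0 k = 0} ->
    flows W X s e (Psi x) (Psi (x + \sum_(k <- s) e 0 k *: delta_mx 0 k)).
Proof.
move=> hPsi; elim=> [e x _ _ _ _|k s IH e x /= /andP[ks us] ed xd x0].
  by rewrite big_nil addr0.
have d0 : 0 < d by apply: le_lt_trans ed.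
have line (t : R) : `|t| < d -> `|x + t *: delta_mx 0 k| < d.
  move=> td; apply: (@le_lt_trans _ _ (Num.max `|x| `|t|)); last first.
    by rewrite gt_max xd.
  apply: rV_norm_le => [|j]; first by rewrite le_max normr_ge0.
  rewrite !mxE eqxx /=; have [->|jk] := eqVneq j k.
    by rewrite x0 ?mem_head // mulr1 add0r le_max lexx orbT.
  by rewrite mulr0 addr0 le_max coord_le_norm.
have ekd : `|e 0 k| < d by exact: le_lt_trans (coord_le_norm _ _) ed.
exists (Psi (x + e 0 k *: delta_mx 0 k)); split.
  exists (- d), d, (fun t => Psi (x + t *: delta_mx 0 k)); split => //.
  - by rewrite oppr_lt0 d0.
  - by rewrite -ltr_norml.
  - by rewrite scale0r addr0.
  - move=> t; rewrite -ltr_norml => td; have [Wt dt Xt] := hPsi _ (line t td).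
    split=> //; rewrite -Xt.
    exact: is_derive_comp (is_derive_line _ _ _) dt.
rewrite big_cons addrA; apply: IH => //; first exact: line.
move=> i si; rewrite !mxE eqxx x0 ?inE ?si ?orbT //=.
have [ik|] := eqVneq i k; last by rewrite mulr0 addr0.
by rewrite ik (negbTE ks) in si.
Qed.

Lemma Riemann_integral_curves m n q (Uhat : set 'rV[R]_m)
    (C : 'rV[R]_m -> 'rV[R]_q) (r : 'I_n -> 'rV[R]_m -> 'rV[R]_m) ul :
  (n + q = m)%N -> Ck 1 Uhat C -> (forall k, Ck 2 Uhat (r k)) ->
  (forall u, Uhat u -> forall k, r k u != 0) ->
  (forall k u, Uhat u -> r k u *m jacobian C u = 0) ->
  (forall u, Uhat u -> row_full (jacobian C u)) ->
  Uhat ul -> C ul = 0 ->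
  Riemann_invariant_coordinates (zero_set Uhat C) Uhat r ul ->
  integral_curves_parameterize (zero_set Uhat C) Uhat r ul.
Proof.
move=> nq CC Cr r0 rC fJ Uhul Cul [U [E [w [psi [UUh co wr]]]]].
have [[oU Uul] oE Cw Cpsi [psiE wpsi]] := co.
have dw u : U u -> differentiable w u by case: Cw => + _; exact.
have dpsi e : E e -> differentiable psi e by case: Cpsi => + _; exact.
have psiM e : E e -> (zero_set Uhat C `&` U) (psi e).
  by move=> Ee; rewrite -psiE; exists e.
(* The inverse of [d i] is the rescaling factor of [r i]; [w] being C^3 and [r i] C^2, it is C^2 as
   required. *)
pose d i u : R^o := 'D_(r i u) w u 0 i.
have Cd i : Ck 2 U (d i).
  by apply: Ck1_derive_row => //; exact: Ck_sub (Cr i).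
have tangent e i : E e -> d i (psi e) != 0 /\
    (d i (psi e))^-1 *: r i (psi e) = 'D_(delta_mx 0 i) psi e.
  move=> Ee; have [[Uhu Cu] Uu] := psiM _ Ee; set u := psi e in Uhu Cu Uu *.
  have PW : jacobian psi e *m jacobian w u = 1%:M.
    exact: left_inverse_jacobian oE Ee (dpsi _ Ee) (dw _ Uu) wpsi.
  have PC : jacobian psi e *m jacobian C u = 0.
    apply: (level_set_jacobian oE Ee (dpsi _ Ee) (CC.1 _ Uhu)).
    by move=> e' /psiM[[]].
  have fP : row_free (jacobian psi e) by apply/row_freeP; exists (jacobian w u).
  (* The rows of the Jacobian of [psi] span the tangent space, so [r i u] has coefficients [y] in
     them; these are the derivatives of [w] along [r i], all zero except the [i]-th, which cannot
     vanish since [r i u] does not. *)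
  have /submxP[y ry] := ker_sub_row_free nq (fJ u Uhu) fP PC (rC i u Uhu).
  have yE : y = 'D_(r i u) w u.
    by rewrite (deriveEjacobian _ (dw _ Uu)) ry -mulmxA PW mulmx1.
  have yd : y = d i u *: delta_mx 0 i.
    apply/rowP => j; rewrite mxE !mxE eqxx /=.
    have [->|ij] := eqVneq j i; first by rewrite mulr1 yE.
    rewrite mulr0 yE derive_mx ?mxE; last exact: diff_derivable (dw _ Uu).
    by apply: wr; [exact: psiM | rewrite eq_sym].
  have d0 : d i u != 0.
    apply/eqP => du; have := r0 u Uhu i.
    by rewrite ry yd du scale0r mul0mx eqxx.
  split=> //; rewrite (deriveEjacobian _ (dpsi _ Ee)) ry yd -scalemxAl.
  by rewrite scalerA mulVf // scale1r.
(* [tangent] gives [d i != 0] only at points of the zero set; off it the domain has to be cut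
   down. *)
pose W := [set u | U u /\ forall i, d i u != 0].
have oW : open W.
  rewrite openE => u [Uu du]; rewrite /W /interior.
  near=> v; split; first by near: v; exact: open_nbhs_nbhs.
  move=> i; move: i; near: v; apply: filter_forall => i.
  have /(cvgr_neq0 _) : {for u, continuous (d i)} by exact: (CkW (CkW (Cd i))) u Uu.
  by apply; exact: du.
have [e0 Ee0 eul] : (psi @` E) ul by rewrite psiE.
have Wpsi e : E e -> W (psi e).
  by move=> Ee; have [_ Uu] := psiM _ Ee; split=> // i; exact: (tangent e i Ee).1.
have wul : w ul = e0 by rewrite -eul wpsi.
have /nbhs_ballP[del /= del0 delE] : nbhs e0 E by exact: open_nbhs_nbhs.
have inE x : `|x| < del -> E (e0 + x).
  by move=> xd; apply: delE; rewrite -ball_normE /= opprD addrA subrr sub0r normrN.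
have oball : open [set x : 'rV[R]_n | `|x| < del].
  have := @ball_open _ _ (0 : 'rV[R]_n) del; rewrite -ball_normE.
  by congr open; apply/seteqP; split => e /=; rewrite sub0r normrN.
exists W, (fun i u => (d i u)^-1); split.
- by split => //; rewrite -eul; exact: Wpsi.
- by move=> u [/UUh].
- by move=> k; apply: CkV => //; [move=> u [_]; exact | apply: Ck_sub (Cd k) => u []].
- by move=> k u [_ du]; rewrite invr_eq0.
(* The coordinates are translated so that [ul] has parameter 0, with a sup-norm ball as range, as
   [coordinate_flows] requires. *)
exists [set u | W u /\ `|w u - e0| < del], [set x | `|x| < del],
  (fun u => w u - e0), (fun x => psi (e0 + x)).
have oU' : open [set u | W u /\ `|w u - e0| < del].
  rewrite openE => u [Wu wu]; rewrite /interior.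
  have cw : {for u, continuous (fun v => w v - e0)}.
    apply: continuousB; last exact: cst_continuous.
    by apply: differentiable_continuous; apply: dw; case: Wu.
  have wnear : \forall v \near u, `|w v - e0| < del.
    by move: cw => /cvgr_norm_lt; apply.
  by near=> v; split; near: v; [exact: open_nbhs_nbhs | exact: wnear].
split; [by move=> u []|by rewrite /= normr0|split|].
- by split=> //; split; [rewrite -eul; exact: Wpsi | rewrite wul subrr normr0].
- exact: oball.
- apply: (@CkD _ _ _ _ _ w (cst (- e0))) => //; last exact: Ck_cst.
  by apply: Ck_sub Cw => u [[]].
- by apply: Ck_sub (Ck_shift e0 Cpsi) => x; exact: inE.
- split=> [|e /= ed]; last by rewrite wpsi; [rewrite addrC addKr | exact: inE].
  apply/seteqP; split => [_ [x /= xd <-]|u [Mu [Wu wu]]].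
    have Ex := inE _ xd; have [Mx _] := psiM _ Ex; split => //; split; first exact: Wpsi.
    by rewrite wpsi // addrC addKr.
  have [e Ee eu] : (psi @` E) u by rewrite psiE; split=> //; case: Wu.
  exists (w u - e0) => //=.
  by rewrite addrC subrK -eu wpsi.
move=> e /= ed s ps.
have us : uniq s by rewrite (perm_uniq ps) enum_uniq.
have := @coordinate_flows m n W (fun k u => (d k u)^-1 *: r k u)
  (fun x => psi (e0 + x)) del _ s e 0 us ed.
(* The composed flows add up the coordinate displacements; over any permutation of the indices the
   sum is [e], whence the independence of the order. *)
rewrite normr0 addr0 eul add0r (perm_big _ ps) /= big_enum /= -row_sum_delta.
apply=> // [x xd|k _]; last by rewrite mxE.
have Ex := inE _ xd; have [Cs1 _] := Ck_shift e0 Cpsi.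
split; [exact: Wpsi|exact: Cs1|move=> k].
have [_ ->] := tangent _ k Ex; rewrite /derive /=.
by under [in LHS]eq_fun do rewrite addrCA.
Unshelve. all: by end_near. Qed.

End Riemann_invariants.

(** * From the determinant and eigenvector hypotheses to the two conclusions *)

Theorem proposition1p4 (R : realType) (m n : nat) (hnm : (n <= m)%N)
    (Uhat : set 'rV[R]_m) (hU : open Uhat)
    (G F : 'rV[R]_m -> 'rV[R]_n) (C : 'rV[R]_m -> 'rV[R]_(m - n))
    (hG : Ck 3 Uhat G) (hF : Ck 3 Uhat F) (hC : Ck 3 Uhat C)
    (hdet : forall u, Uhat u ->
      \det (castmx (subnKC hnm, erefl m) (col_mx (Jac G u) (Jac C u))) != 0)
    (r : 'I_n -> 'rV[R]_m -> 'rV[R]_m) (lam : 'I_n -> 'rV[R]_m -> R)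
    (hr2 : forall k, Ck 2 Uhat (r k))
    (hr0 : forall u, Uhat u -> forall k, r k u != 0)
    (heig : forall u, Uhat u -> forall k,
      (lam k u *: Jac G u - Jac F u) *m (r k u)^T = 0)
    (hCr : forall u, Uhat u -> forall k, Jac C u *m (r k u)^T = 0)
    (hlam : forall u, Uhat u -> forall i j : 'I_n, (i < j)%N ->
      lam i u < lam j u) :
  forall ul : 'rV[R]_m, zero_set Uhat C ul ->
    (exists (U : set 'rV[R]_m) (E : set 'rV[R]_n),
      [/\ open_nbhs ul U, U `<=` Uhat, open_nbhs (0 : 'rV[R]_n) E,
          forall e, E e -> exists u, flows Uhat r (enum 'I_n) e ul u &
          zero_set Uhat C `&` U =
            [set u | Uhat u /\
               exists2 e, E e & flows Uhat r (enum 'I_n) e ul u]])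
    /\
    (integral_curves_parameterize (zero_set Uhat C) Uhat r ul <->
     Riemann_invariant_coordinates (zero_set Uhat C) Uhat r ul).
Proof.
move=> ul [Uul Cul]; have nq := subnKC hnm.
have rC k u : Uhat u -> r k u *m jacobian C u = 0.
  by move=> Uu; apply: trmx_inj; rewrite trmx_mul trmx0; exact: hCr.
have inj u : Uhat u -> forall v : 'rV_m,
    v *m jacobian G u = 0 -> v *m jacobian C u = 0 -> v = 0.
  move=> Uu v vG vC; apply: castmx_col_mx_inj (hdet u Uu) _ _;
    by rewrite /Jac trmxK.
have fC u : Uhat u -> row_full (jacobian C u).
  by move=> Uu; exact: ker_row_full nq (inj u Uu).
have fr : row_free (\matrix_k r k ul).
  apply: (@eigvec_row_free _ _ _ _ _ (jacobian G ul) (jacobian F ul)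
    (jacobian C ul) _ (lam^~ ul)); last exact: inj.
  - move=> i j lij; apply/val_inj; case: (ltngtP i j) => // h;
      by have := hlam _ Uul _ _ h; rewrite lij ltxx.
  - by move=> k; rewrite rowK; exact: hr0.
  - by move=> k; rewrite rowK; exact: eigvec_trmx (heig _ Uul k).
  - by apply/row_matrixP => k; rewrite row_mul rowK row0; exact: rC.
have CC : Ck 1 Uhat C by do 2 apply: CkW.
split.
  apply: (flows_zero_set nq hU Uul Cul CC _ rC (fC _ Uul) fr) => k.
  exact: CkW.
split; first exact: integral_curves_Riemann hr2.
exact: (Riemann_integral_curves nq CC hr2 hr0 rC fC Uul Cul).
Qed.
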